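(* Let $K$ be a field of characteristic $p>2$, let $E$ be a finite-dimensional $K$-vector space with a flag $\mathcal F$, and let $x_1,\dots,x_n$ be a basis of $E$ compatible with $\mathcal F$, with heights $m_1,\dots,m_n$. (1) Every contact form corresponding to the flag $\mathcal F$ is conjugate under $G(\mathcal F)$ to a form $$f\,(dx_{i_0}+x_{i_1}dx_{i_1'}+\dots+x_{i_s}dx_{i_s'}),\qquad(\ast)$$ where $f\in\mathcal O(\mathcal F)^\times$, $i_0\in\{1,\dots,n\}$ is an index, $\{i_1,i_1'\},\dots,\{i_s,i_s'\}$ is a partition of the set $\{1,\dots,n\}\setminus\{i_0\}$ into pairs, and $s=(n-1)/2$. (2) Let $(\ast)$ be such a form, let $j_0\in\{1,\dots,n\}$ and let $\{j_1,j_1''\},\dots,\{j_s,j_s''\}$ be a partition of $\{1,\dots,n\}\setminus\{j_0\}$ into pairs. The form $(\ast)$ is conjugate under $G(\mathcal F)$, for some $g\in\mathcal O(\mathcal F)^\times$, to the form $$g\,(dx_{j_0}+x_{j_1}dx_{j_1''}+\dots+x_{j_s}dx_{j_s''})$$ if and only if there exists a permutation of $\{1,\dots,n\}$ which sends $i_0$ to $j_0$, sends every pair of the partition $\{i_1,i_1'\},\dots,\{i_s,i_s'\}$ to a pair of the partition $\{j_1,j_1''\},\dots,\{j_s,j_s''\}$, and maps each subset of indices of equal height $\{i\mid m_i=q\}$ into itself.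
   Context: Flag and heights. $\mathcal F:\ E=E_0\supseteq E_1\supseteq\dots\supseteq 0=E_m=E_{m+1}=\dots$ is a flag of subspaces of $E$ (equal terms allowed). A basis $x_1,\dots,x_n$ of $E$ is compatible with $\mathcal F$ if each $E_k$ is spanned by the $x_i$ lying in it; the height of $x_i$ is $m_i=\min\{k\mid x_i\notin E_k\}$. Algebras. $\mathcal O(E)$ is the divided power algebra of $E$: the commutative unital $K$-algebra with generators $x^{(r)}$ ($x\in E$, $r\ge 0$) and relations $x^{(0)}=1$, $(x+y)^{(r)}=\sum_{i=0}^r x^{(i)}y^{(r-i)}$, $(\lambda x)^{(r)}=\lambda^r x^{(r)}$, $x^{(r)}x^{(s)}=\binom{r+s}{r}x^{(r+s)}$ ($x^{(1)}$ is identified with $x$). It has a basis of monomials $x_1^{(\alpha_1)}\cdots x_n^{(\alpha_n)}$. $\mathcal O(\mathcal F)$ is the subalgebra generated by all $x^{(r)}$ with $x\in E_i$, $r<p^{i+1}$, $i\ge 0$; it is spanned by the monomials with $\alpha_i<p^{m_i}$ for all $i$. The ideal $\mathfrak m(E)$ (resp. $\mathfrak m(\mathcal F)$) of $\mathcal O(E)$ (resp. $\mathcal O(\mathcal F)$) is spanned by its nonconstant monomials. There is a unique system of divided powers $f\mapsto f^{(r)}$ on the ideal $\mathfrak m(E)$ of $\mathcal O(E)$ (satisfying the usual divided power axioms) which extends $x\mapsto x^{(r)}$, $x\in E$. Derivations and forms. Let $\partial_i$ be the derivation with $\partial_i(x_j^{(r)})=\delta_{ij}x_j^{(r-1)}$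 and $W(\mathcal F)=\bigoplus_i\mathcal O(\mathcal F)\partial_i$. $\Omega^k(\mathcal F)$ is the space of alternating $\mathcal O(\mathcal F)$-multilinear maps $W(\mathcal F)^k\to\mathcal O(\mathcal F)$, with the usual $\wedge$ and $d$; it is free over $\mathcal O(\mathcal F)$ on the $dx_{i_1}\wedge\dots\wedge dx_{i_k}$, $i_1<\dots<i_k$. For $\delta\in W(\mathcal F)$, $\delta\lrcorner\,\omega$ denotes contraction, $(\delta\lrcorner\,\omega)(\delta_1,\dots)=\omega(\delta,\delta_1,\dots)$. Contact forms. For $\omega\in\Omega^1(\mathcal F)$ put $P_\omega=\{\delta\in W(\mathcal F)\mid\delta\lrcorner\,d\omega=0\}$ and $Q_\omega=\{\delta\in W(\mathcal F)\mid\omega(\delta)=0\}$. A contact form corresponding to $\mathcal F$ is a form $\omega\in\Omega^1(\mathcal F)$ such that $W(\mathcal F)=P_\omega\oplus Q_\omega$. Group. $G(\mathcal F)$ is the group of $K$-algebra automorphisms $\sigma$ of $\mathcal O(\mathcal F)$ such that for all $f\in\mathfrak m(\mathcal F)$ and $r\ge 0$: $f^{(r)}\in\mathcal O(\mathcal F)$ if and only if $(\sigma f)^{(r)}\in\mathcal O(\mathcal F)$, and in that case $\sigma(f^{(r)})=(\sigma f)^{(r)}$. It acts on $\Omega(\mathcal F)$ by $(\sigma\omega)(\delta_1,\dots,\delta_k)=\sigma\,\omega(\sigma^{-1}\delta_1\sigma,\dots,\sigma^{-1}\delta_k\sigma)$. Two forms are conjugate under $G(\mathcal F)$ if they lie in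 one orbit. *)

(* Defs.v *)
From HB Require Import structures.
From mathcomp Require Import all_boot all_order all_fingroup all_algebra.
From mathcomp Require Import boolp functions.

Set Implicit Arguments.
Unset Strict Implicit.
Unset Printing Implicit Defensive.
Import GRing.Theory.
Local Open Scope ring_scope.

Section Flag.
Context {K : fieldType} {E : vectType K}.

Definition is_flag (F : nat -> {vspace E}) : Prop :=
  [/\ F 0%N = fullv,
      forall k, (F k.+1 <= F k)%VS
    & exists N, forall k, (N <= k)%N -> F k = 0%VS].

Definition compatible_basis n (F : nat -> {vspace E}) (x : n.-tuple E) : Prop :=
  basis_of fullv x /\ forall k, F k = <<[seq v <- x | v \in F k]>>%VS.

(* h = min {k | v \notin F k} *)
Definition is_height (F : nat -> {vspace E}) (v : E) (h : nat) : Prop :=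
  v \notin F h /\ forall k, v \notin F k -> (h <= k)%N.

End Flag.

Section DividedPowers.
Context {K : fieldType} {E : vectType K}.

(* dp v r stands for v^(r). *)
Definition divpow_relations (A : comAlgType K) (dp : E -> nat -> A) : Prop :=
  [/\ forall v, dp v 0%N = 1,
      forall u v r, dp (u + v) r = \sum_(i < r.+1) dp u i * dp v (r - i)%N,
      forall (c : K) v r, dp (c *: v) r = c ^+ r *: dp v r
    & forall v r s, dp v r * dp v s = 'C(r + s, r)%:R * dp v (r + s)%N].

(* (A, dp) is presented by the generators v^(r) and the relations above; the
   presentation is expressed by its universal property.  Since comAlgType only
   contains nonzero algebras, B is nonzero, which is harmless: there is exactly
   one map to the zero algebra. *)
Definition is_divpow_algebra (A : comAlgType K) (dp : E -> nat -> A) : Prop :=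
  [/\ divpow_relations dp,
      forall (B : comAlgType K) (dpB : E -> nat -> B), divpow_relations dpB ->
        exists phi : {lrmorphism A -> B}, forall v r, phi (dp v r) = dpB v r
    & forall (B : comAlgType K) (phi psi : {lrmorphism A -> B}),
        (forall v r, phi (dp v r) = psi (dp v r)) -> phi =1 psi].

Definition in_span (V : lmodType K) (S : V -> Prop) (v : V) : Prop :=
  exists s : seq (K * V),
    (forall cu, cu \in s -> S cu.2) /\ v = \sum_(cu <- s) cu.1 *: cu.2.

Definition monomial n (A : comAlgType K) (dp : E -> nat -> A) (x : n.-tuple E)
  (alpha : 'I_n -> nat) : A := \prod_(i < n) dp (tnth x i) (alpha i).

(* The span of the nonconstant monomials, i.e. the ideal m(E) when x is a basis
   of E. *)
Definition mE n (A : comAlgType K) (dp : E -> nat -> A) (x : n.-tuple E) :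
    A -> Prop :=
  in_span (fun u => exists2 alpha : 'I_n -> nat,
    (exists i, alpha i != 0%N) & u = monomial dp x alpha).

(* A system of divided powers on an ideal M of A; gam f r stands for f^(r), and
   the values of gam outside of M are irrelevant. *)
Definition is_divpow_system (A : comNzRingType) (M : A -> Prop)
    (gam : A -> nat -> A) : Prop :=
  [/\ forall f, M f -> gam f 0%N = 1 /\ gam f 1%N = f,
      forall f r, M f -> (0 < r)%N -> M (gam f r),
      forall f g r, M f -> M g ->
        gam (f + g) r = \sum_(i < r.+1) gam f i * gam g (r - i)%N,
      forall a f r, M f -> gam (a * f) r = a ^+ r * gam f r
    & (forall f r s, M f ->
        gam f r * gam f s = 'C(r + s, r)%:R * gam f (r + s)%N)
      /\ (forall f r s, M f -> (0 < r)%N ->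
        gam (gam f r) s
          = ((r * s)`! %/ (r`! ^ s * s`!))%:R * gam f (r * s)%N)].

Definition extends_dp (A : comAlgType K) (dp : E -> nat -> A)
    (gam : A -> nat -> A) : Prop :=
  forall v r, gam (dp v 1%N) r = dp v r.

End DividedPowers.

Section FlagAlgebra.
Context {K : fieldType} (p : nat) {E : vectType K} (F : nat -> {vspace E}).
Context {A : comAlgType K} (dp : E -> nat -> A).

(* Membership in the subalgebra generated by S, i.e. in every unital
   subalgebra containing S. *)
Definition in_subalg (S : A -> Prop) (f : A) : Prop :=
  forall B : A -> Prop,
    (forall g, S g -> B g) -> B 1 ->
    (forall (c : K) g h, B g -> B h -> B (c *: g + h)) ->
    (forall g h, B g -> B h -> B (g * h)) -> B f.

Definition flag_generator (f : A) : Prop :=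
  exists i v r, [/\ v \in F i, (r < p ^ i.+1)%N & f = dp v r].

Definition flag_pred : {pred A} := fun f => `[< in_subalg flag_generator f >].

Lemma flag_predP f : reflect (in_subalg flag_generator f) (f \in flag_pred).
Proof. exact: asboolP. Qed.

Lemma flag_pred_subalg : subalg_closed flag_pred.
Proof.
split.
- by apply/flag_predP => B _ B1 _ _.
- move=> c g h /flag_predP Hg /flag_predP Hh; apply/flag_predP => B SB B1 BL BM.
  exact: (BL c g h (Hg B SB B1 BL BM) (Hh B SB B1 BL BM)).
- move=> g h /flag_predP Hg /flag_predP Hh; apply/flag_predP => B SB B1 BL BM.
  exact: (BM g h (Hg B SB B1 BL BM) (Hh B SB B1 BL BM)).
Qed.
HB.instance Definition _ := GRing.isSubalgClosed.Build K A flag_pred flag_pred_subalg.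

(* O(F), the subalgebra generated by the v^(r) with v in F i, r < p^(i+1), as a
   K-algebra of its own. *)
Record flag_algebra :=
  FlagAlgebra { flag_val : A; _ : flag_val \in flag_pred }.

HB.instance Definition _ := [isSub for flag_val].
HB.instance Definition _ := [Choice of flag_algebra by <:].
HB.instance Definition _ := [SubChoice_isSubComNzRing of flag_algebra by <:].
HB.instance Definition _ := [SubZmodule_isSubLmodule of flag_algebra by <:].
HB.instance Definition _ :=
  [SubNzRing_SubLmodule_isSubLalgebra of flag_algebra by <:].
HB.instance Definition _ := [SubLalgebra_isSubAlgebra of flag_algebra by <:].

(* v = v^(1) as an element of O(F).  The default value 0 is never used: see
   flag_elemE. *)
Definition flag_elem (v : E) : flag_algebra := insubd (0 : flag_algebra) (dp v 1%N).

Lemma flag_elemE v : is_flag F -> (1 < p)%N -> \val (flag_elem v) = dp v 1%N.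
Proof.
move=> [F0 _ _] p1; rewrite /flag_elem val_insubd ifT //.
apply/flag_predP => B SB _ _ _; apply: SB; exists 0%N, v, 1%N.
by rewrite F0 memvf expn1.
Qed.

Definition mF n (x : n.-tuple E) (m : 'I_n -> nat) (u : flag_algebra) : Prop :=
  in_span (fun w => exists alpha : 'I_n -> nat,
    [/\ exists i, alpha i != 0%N, forall i, (alpha i < p ^ m i)%N
      & w = monomial dp x alpha]) (\val u).

Definition is_derivation (D : flag_algebra -> flag_algebra) : Prop :=
  linear D /\ forall u v, D (u * v) = D u * v + u * D v.

(* D i is the derivation mapping x_j^(r) to delta_ij x_j^(r-1). *)
Definition is_partials n (x : n.-tuple E)
    (D : 'I_n -> flag_algebra -> flag_algebra) : Prop :=
  forall i, is_derivation (D i) /\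
    forall j r (u : flag_algebra), \val u = dp (tnth x j) r ->
      \val (D i u) =
        if (i == j) && (0 < r)%N then dp (tnth x j) r.-1 else 0.

End FlagAlgebra.

Section DerivationsAndForms.
Context {K : fieldType} {p : nat} {E : vectType K} {F : nat -> {vspace E}}.
Context {A : comAlgType K} {dp : E -> nat -> A} {n : nat}.
Local Notation OF := (flag_algebra p F dp).
Variable D : 'I_n -> OF -> OF.

Definition W_pred : {pred (OF -> OF^o)} :=
  fun delta => `[< exists c : 'I_n -> OF,
    forall u, delta u = \sum_(i < n) c i * D i u >].

Lemma W_predP (delta : OF -> OF^o) :
  reflect (exists c : 'I_n -> OF, forall u, delta u = \sum_(i < n) c i * D i u)
          (delta \in W_pred).
Proof. exact: asboolP. Qed.

Lemma W_pred_submod : submod_closed W_pred.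
Proof.
split; first by apply/W_predP; exists (fun=> 0) => u;
  rewrite big1 // => i _; rewrite mul0r.
move=> a d e /W_predP[b Hb] /W_predP[c Hc]; apply/W_predP.
exists (fun i => a * b i + c i) => u.
rewrite [LHS](_ : _ = a * d u + e u) // Hb Hc mulr_sumr -big_split /=.
by apply: eq_bigr => i _; rewrite mulrDl mulrA.
Qed.
HB.instance Definition _ :=
  GRing.isSubmodClosed.Build OF (OF -> OF^o) W_pred W_pred_submod.

(* W(F), the O(F)-module of the endomaps \sum_i c_i D_i of O(F). *)
Record W := MkW { W_val :> OF -> OF^o; _ : W_val \in W_pred }.

HB.instance Definition _ := [isSub for W_val].
HB.instance Definition _ := [Choice of W by <:].
HB.instance Definition _ := [SubChoice_isSubLmodule of W by <:].

Lemma partial_in_W i : (D i : OF -> OF^o) \in W_pred.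
Proof.
apply/W_predP; exists (fun j => (j == i)%:R) => u.
rewrite (bigD1 i) //= eqxx mul1r big1 ?addr0 // => j /negPf ->.
by rewrite mul0r.
Qed.
Definition partial (i : 'I_n) : W := MkW (partial_in_W i).

Definition is_form1 (omega : W -> OF^o) : Prop := scalar omega.

Definition d0 (u : OF) : W -> OF^o := fun delta => delta u.

Definition wedge (al be : W -> OF^o) : W -> W -> OF^o :=
  fun d1 d2 => al d1 * be d2 - al d2 * be d1.

(* d (\sum_i f_i dx_i) = \sum_i df_i /\ dx_i, where f_i = omega (partial i). *)
Definition d1 (x : n.-tuple E) (omega : W -> OF^o) : W -> W -> OF^o :=
  \sum_(i < n) wedge (d0 (omega (partial i))) (d0 (flag_elem p F dp (tnth x i))).

Definition contract (delta : W) (eta : W -> W -> OF^o) : W -> OF^o := eta delta.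

Definition P_of (x : n.-tuple E) (omega : W -> OF^o) (delta : W) : Prop :=
  contract delta (d1 x omega) = 0.

Definition Q_of (omega : W -> OF^o) (delta : W) : Prop := omega delta = 0.

Definition W_direct_sum (P Q : W -> Prop) : Prop :=
  (forall delta, exists a b, [/\ P a, Q b & delta = a + b]) /\
  (forall delta, P delta -> Q delta -> delta = 0).

Definition contact_form (x : n.-tuple E) (omega : W -> OF^o) : Prop :=
  is_form1 omega /\ W_direct_sum (P_of x omega) (Q_of omega).

(* sigma belongs to G(F), with inverse sigma'. *)
Definition in_group (x : n.-tuple E) (m : 'I_n -> nat) (gam : A -> nat -> A)
    (sigma : {lrmorphism OF -> OF}) (sigma' : OF -> OF) : Prop :=
  [/\ cancel sigma sigma', cancel sigma' sigma
    & forall (f : OF) r, mF x m f ->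
        (gam (\val f) r \in flag_pred p F dp <->
         gam (\val (sigma f)) r \in flag_pred p F dp) /\
        (forall h : OF, \val h = gam (\val f) r ->
           \val (sigma h) = gam (\val (sigma f)) r)].

(* eta = sigma omega.  The derivation sigma^-1 delta sigma is required to belong
   to W(F), so that omega can be evaluated at it. *)
Definition is_image (sigma sigma' : OF -> OF) (omega eta : W -> OF^o) : Prop :=
  forall delta : W, exists2 delta' : W,
    (forall u, delta' u = sigma' (delta (sigma u)))
    & eta delta = sigma (omega delta').

Definition forms_conjugate (x : n.-tuple E) (m : 'I_n -> nat) (gam : A -> nat -> A)
    (omega eta : W -> OF^o) : Prop :=
  exists (sigma : {lrmorphism OF -> OF}) (sigma' : OF -> OF),
    in_group x m gam sigma sigma' /\ is_image sigma sigma' omega eta.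

(* f (dx_{i0} + \sum_k x_{a k} dx_{b k}) *)
Definition std_form (x : n.-tuple E) s (f : OF) (i0 : 'I_n)
    (a b : 'I_s -> 'I_n) : W -> OF^o :=
  let X i := flag_elem p F dp (tnth x i) in
  f *: (d0 (X i0) + \sum_(k < s) X (a k) *: d0 (X (b k))).

End DerivationsAndForms.
Arguments std_form {K p E F A dp n} D x {s} f i0 a b.

Definition invertible (R : comNzRingType) (f : R) : Prop := exists g, f * g = 1.

(* The sets {a k, b k} form a partition of {1, ..., n} \ {i0} into s pairs. *)
Definition pair_partition n s (i0 : 'I_n) (a b : 'I_s -> 'I_n) : Prop :=
  [/\ forall k, a k != b k,
      forall k l : 'I_s, k != l ->
        [disjoint [set a k; b k] & [set a l; b l]]
    & \bigcup_(k < s) [set a k; b k] = [set~ i0]].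

(* Main.v *)
Require Import Defs.
From HB Require Import structures.
From mathcomp Require Import all_boot all_order all_fingroup all_algebra.
From mathcomp Require Import boolp functions.
From mathcomp Require Import ring zify.
Import GRing.Theory.
Set Implicit Arguments.
Unset Strict Implicit.
Unset Printing Implicit Defensive.
Local Open Scope ring_scope.

(** For a unit [f] the kernel of [f * omega] is that of [omega], and inside the
    kernel [d omega] is nondegenerate; hence contact forms up to units have no
    local cohomological invariants, and only their 1-jet at the closed point
    matters.  Write [omega(0) = c] and [B = d omega(0)].

    - Linear algebra: [c] and [B] can be put in the standard shape by a basis
      change compatible with the flag (elimination, choosing pivots of minimal
      height).
    - After multiplication by a unit and a change of [y_0] by an element of
      [m ^ 2], [omega = f (dy_0 + \sum y_a dy_b + h)] with [h] in [m ^ 2].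
      Writing [h = \sum (h_a dy_a + h_b dy_b)] up to a unit, the substitution
      [y_a + h_b, y_b - h_a, y_0 + \sum y_a h_a] leaves exactly the error
      [\sum h_b dh_a], so a Newton iteration converges.
    - All corrections lie in [m ^ 2], every element of which has all its divided
      powers in [O(F)]; so the new coordinates define an element of [G(F)].

    Conversely the linear part [N] of an element of [G(F)] satisfies
    [N i j <> 0 -> m i <= m j].  So it carries the blocks of [B] cut out by
    [m i < q, m j < r] to the corresponding blocks, and their ranks count the
    pairs of given heights. *)

(** * Partitions into pairs *)

(** The contact condition is stated over [O(F)], while the linear algebra needs [c] nonzero and [B]
    nondegenerate on the kernel of [c], over [K]. The socle bridges the gap: a nonzero [t] killed by
    the maximal ideal turns a vanishing at the closed point into a vanishing in [O(F)], so that the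
    directness of P and Q applies to [t] times a field. The assumption p > 2 enters when a residual
    form with symmetric Jacobian at the point is integrated up to order two, which divides by 2.
    Elements of m ^ 2 have all divided powers because (g h)^(r) = g^r h^(r): for r >= p the factor
    g^r = r! g^(r) vanishes, and for r < p one can divide h^r by r!. Coordinate changes are first
    made on the whole of [A], where the universal property provides the substitution, and then
    restricted to [O(F)]; there injectivity comes from the Jacobian and surjectivity from finite
    dimension. *)

Section PairPartition.
Variables (n s : nat) (i0 : 'I_n) (a b : 'I_s -> 'I_n).
Hypothesis hab : pair_partition i0 a b.

Lemma pair_neq k l : a k != b l.
Proof.
have [h1 h2 _] := hab; have [->|/h2] := eqVneq k l; first exact: h1.
rewrite disjoints_subset subUset sub1set !inE negb_or => /andP[/andP[_ ?] _].
by [].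
Qed.

Lemma pair_injl : injective a.
Proof.
have [_ h2 _] := hab; move=> k l akl; apply/eqP/idPn => /h2.
by rewrite disjoints_subset subUset sub1set !inE akl eqxx.
Qed.

Lemma pair_injr : injective b.
Proof.
have [_ h2 _] := hab; move=> k l akl; apply/eqP/idPn => /h2.
by rewrite disjoints_subset subUset !sub1set !inE akl eqxx orbT andbF.
Qed.

Lemma pair_notin k : a k != i0 /\ b k != i0.
Proof.
have [_ _ h3] := hab.
have h i : i \in [set a k; b k] -> i != i0.
  move=> ik; have : i \in [set~ i0] by rewrite -h3; apply/bigcupP; exists k.
  by rewrite !inE.
by split; apply: h; rewrite !inE eqxx ?orbT.
Qed.

Lemma pair_cover i : i != i0 -> exists k, i = a k \/ i = b k.
Proof.
have [_ _ h3] := hab; move=> ii0.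
have : i \in \bigcup_k [set a k; b k] by rewrite h3 !inE.
by case/bigcupP => k _; rewrite !inE => /orP[]/eqP ->; exists k; [left|right].
Qed.

Lemma pair_ind (P : 'I_n -> Prop) :
  P i0 -> (forall k, P (a k)) -> (forall k, P (b k)) -> forall i, P i.
Proof.
move=> P0 Pa Pb i; have [->//|/pair_cover[k [->|->]]] := eqVneq i i0;
  by [apply: Pa|apply: Pb].
Qed.

(** Under [hab] the last branch is reached at [i0] alone, so [y0] is at once the default and the
    value at [i0]. *)
Definition pair_glue T (y0 : T) (ya yb : 'I_s -> T) (i : 'I_n) : T :=
  if [pick k | a k == i] is Some k then ya k
  else if [pick k | b k == i] is Some k then yb k else y0.

Lemma pair_glue0 T (y0 : T) ya yb : pair_glue y0 ya yb i0 = y0.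
Proof.
rewrite /pair_glue; case: pickP => [k|_]; first by rewrite (negPf (pair_notin k).1).
by case: pickP => [k|//]; rewrite (negPf (pair_notin k).2).
Qed.

Lemma pair_gluel T (y0 : T) ya yb k : pair_glue y0 ya yb (a k) = ya k.
Proof.
rewrite /pair_glue; case: pickP => [l /eqP /pair_injl ->//|/(_ k)].
by rewrite eqxx.
Qed.

Lemma pair_gluer T (y0 : T) ya yb k : pair_glue y0 ya yb (b k) = yb k.
Proof.
rewrite /pair_glue; case: pickP => [l|_]; first by rewrite (negPf (pair_neq l k)).
case: pickP => [l /eqP /pair_injr ->//|/(_ k)].
by rewrite eqxx.
Qed.

Lemma big_pair (V : nmodType) (G : 'I_n -> V) :
  \sum_i G i = G i0 + \sum_k (G (a k) + G (b k)).
Proof.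
rewrite (bigD1 i0) //=; congr (_ + _).
have [h1 h2 h3] := hab.
rewrite (eq_bigl (mem (\bigcup_k [set a k; b k]))); last first.
  by move=> i; rewrite h3 !inE.
rewrite (partition_disjoint_bigcup _ (F := fun k => [set a k; b k])) //=.
by apply: eq_bigr => k _; rewrite big_setU1 ?inE ?h1 //= big_set1.
Qed.

End PairPartition.

Lemma pair_partition_size n s (i0 : 'I_n) (a b : 'I_s -> 'I_n) :
  pair_partition i0 a b -> n = s.*2.+1.
Proof.
move=> /big_pair h; have := h nat (fun => 1%N).
rewrite !sum_nat_const !card_ord /=.
by rewrite -[(_ + _)%R]/(_ + _)%N; lia.
Qed.

(** * Newton iteration for contact forms *)

Section DerivationTheory.
Variables (K : fieldType) (A : comAlgType K) (d : A -> A).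
Hypothesis dL : linear d.
Hypothesis dM : forall f g, d (f * g) = d f * g + f * d g.

Lemma drvD f g : d (f + g) = d f + d g.
Proof. by have := dL 1 f g; rewrite !scale1r. Qed.
Lemma drv0 : d 0 = 0.
Proof. by apply: (addrI (d 0)); rewrite -drvD !addr0. Qed.
Lemma drvZ c f : d (c *: f) = c *: d f.
Proof. by have := dL c f 0; rewrite drv0 !addr0. Qed.
Lemma drvN f : d (- f) = - d f.
Proof. by rewrite -scaleN1r drvZ scaleN1r. Qed.
Lemma drvB f g : d (f - g) = d f - d g.
Proof. by rewrite drvD drvN. Qed.
Lemma drv_sum I (r : seq I) (P : pred I) (G : I -> A) :
  d (\sum_(k <- r | P k) G k) = \sum_(k <- r | P k) d (G k).
Proof. exact: (big_morph d drvD drv0). Qed.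
Lemma drv1 : d 1 = 0.
Proof. by apply: (addrI (d 1)); rewrite addr0 -{3}[1]mulr1 dM mulr1 mul1r. Qed.
Lemma drv_scalar c : d (c%:A) = 0.
Proof. by rewrite drvZ drv1 scaler0. Qed.
Lemma drv_natl k f : d (k%:R * f) = k%:R * d f.
Proof. by rewrite dM -scaler_nat drv_scalar mul0r add0r scaler_nat. Qed.
Lemma drvX f k : d (f ^+ k.+1) = k.+1%:R * f ^+ k * d f.
Proof.
elim: k => [|k IH]; first by rewrite expr1 expr0 !mul1r.
by rewrite exprS dM IH -[k.+2%:R]natr1 exprS; ring.
Qed.

End DerivationTheory.

(** * Powers of the maximal ideal of a local algebra *)

Section MaximalIdealPowers.
Variables (K : fieldType) (O : comAlgType K) (eps : {rmorphism O -> K}).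
Hypothesis epsZ : forall c u, eps (c *: u) = c * eps u.

(** The k-th power of the kernel of [eps], generated inductively so that product and derivation
    rules follow by induction on membership. *)
Inductive mpow : nat -> O -> Prop :=
| mpow_all f : mpow 0 f
| mpow_step k g h : eps g = 0 -> mpow k h -> mpow k.+1 (g * h)
| mpow_zero k : mpow k 0
| mpow_add k f g : mpow k f -> mpow k g -> mpow k (f + g).

Lemma mpow_mull k u f : mpow k f -> mpow k (u * f).
Proof.
elim=> [g|j g h g0 mh IH|j|j g h _ IHg _ IHh].
- exact: mpow_all.
- by rewrite mulrCA; apply: mpow_step.
- by rewrite mulr0; apply: mpow_zero.
- by rewrite mulrDr; apply: mpow_add.
Qed.

Lemma mpow_scale k c f : mpow k f -> mpow k (c *: f).
Proof. by rewrite -mulr_algl; apply: mpow_mull. Qed.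

Lemma mpow_opp k f : mpow k f -> mpow k (- f).
Proof. by rewrite -mulN1r; apply: mpow_mull. Qed.

Lemma mpow_sub k f g : mpow k f -> mpow k g -> mpow k (f - g).
Proof. by move=> mf mg; apply: mpow_add => //; apply: mpow_opp. Qed.

Lemma mpow_sum k I (r : seq I) (P : pred I) (G : I -> O) :
  (forall i, mpow k (G i)) -> mpow k (\sum_(i <- r | P i) G i).
Proof. by move=> mG; elim/big_ind: _ => //; [apply: mpow_zero|apply: mpow_add]. Qed.

Lemma mpow_mul k l f g : mpow k f -> mpow l g -> mpow (k + l) (f * g).
Proof.
move=> mf mg; elim: mf => [u|j u h u0 mh IH|j|j u v _ IHu _ IHv].
- exact: mpow_mull.
- by rewrite -mulrA addSn; apply: mpow_step.
- by rewrite mul0r; apply: mpow_zero.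
- by rewrite mulrDl; apply: mpow_add.
Qed.

Lemma mpow_pred k f : mpow k.+1 f -> mpow k f.
Proof.
move el: k.+1 => l mf.
elim: mf k el => [//|j g h g0 mh IH k [->]|j k [_]|j g h _ IHg _ IHh k ek].
- by apply: mpow_mull.
- exact: mpow_zero.
- by apply: mpow_add; [apply: IHg|apply: IHh].
Qed.

Lemma mpow_le k l f : (k <= l)%N -> mpow l f -> mpow k f.
Proof.
move=> kl; rewrite -(subnK kl); elim: (l - k)%N => [//|j IH].
by rewrite addSn => /mpow_pred.
Qed.

Lemma mpow1P f : mpow 1 f <-> eps f = 0.
Proof.
split=> [|f0]; last by rewrite -[f]mulr1; apply: mpow_step => //; apply: mpow_all.
move el: 1%N => l mf.
elim: mf el => [//|j g h g0 mh IH _|j _|j g h _ IHg _ IHh ek].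
- by rewrite rmorphM g0 mul0r.
- by rewrite rmorph0.
- by rewrite rmorphD IHg ?IHh ?addr0.
Qed.

Lemma eps_scalar c : eps (c%:A) = c.
Proof. by rewrite epsZ rmorph1 mulr1. Qed.

Hypothesis nilp : exists N, forall f, mpow N f -> f = 0.

(** A geometric series: [u] is its constant term times [1 - z] with [z] nilpotent. *)
Lemma local_unit u : eps u != 0 -> invertible u.
Proof.
have [N hN] := nilp; move=> u0.
set c := eps u in u0; pose z := 1 - c^-1 *: u.
have z0 : eps z = 0 by rewrite rmorphB rmorph1 epsZ mulVf ?subrr.
have zk k : mpow k (z ^+ k).
  by elim: k => [|k IH]; [apply: mpow_all|rewrite exprS; apply: mpow_step].
exists (c^-1 *: \sum_(i < N) z ^+ i).
have cu : c^-1 *: u = 1 - z by rewrite opprB addrC subrK.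
rewrite -scalerAr scalerAl cu.
have -> : (1 - z) * \sum_(i < N) z ^+ i = - (z ^+ N - 1) by rewrite subrX1; ring.
by rewrite (hN (z ^+ N)) // sub0r opprK.
Qed.

Lemma local_mxinv n (J : 'M[O]_n) : map_mx eps J \in unitmx ->
  exists J' : 'M[O]_n, J *m J' = 1%:M /\ J' *m J = 1%:M.
Proof.
rewrite unitmxE det_map_mx unitfE => /local_unit[e he].
exists (e *: \adj J); split.
  by rewrite -scalemxAr mul_mx_adj scale_scalar_mx mulrC he.
by rewrite -scalemxAl mul_adj_mx scale_scalar_mx mulrC he.
Qed.

End MaximalIdealPowers.

(** * Normal form of a 1-form whose 1-jet at the point is standard *)

Section ContactNormalForm.
Variables (K : fieldType) (O : comAlgType K) (eps : {rmorphism O -> K}).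
Hypothesis epsZ : forall c u, eps (c *: u) = c * eps u.
Variables (n : nat) (D : 'I_n -> O -> O) (X : 'I_n -> O).
Hypothesis DL : forall i, linear (D i).
Hypothesis DM : forall i u v, D i (u * v) = D i u * v + u * D i v.
Hypothesis DX : forall i j, D i (X j) = (i == j)%:R.
Hypothesis X0 : forall i, eps (X i) = 0.
Hypothesis nilp : exists N, forall f, mpow eps N f -> f = 0.

Let DD i u v : D i (u + v) = D i u + D i v := drvD (DL i) u v.
Let D0 i : D i 0 = 0 := drv0 (DL i).
Let DZ i c u : D i (c *: u) = c *: D i u := drvZ (DL i) c u.
Let DB i u v : D i (u - v) = D i u - D i v := drvB (DL i) u v.
Let Dsum i I (r : seq I) (P : pred I) (G : I -> O) :
  D i (\sum_(k <- r | P k) G k) = \sum_(k <- r | P k) D i (G k).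
Proof. exact: drv_sum. Qed.

Lemma mpow_deriv k i f : mpow eps k.+1 f -> mpow eps k (D i f).
Proof.
move el: k.+1 => l mf.
elim: mf k el => [//|j g h g0 mh IH k [ej]|j k _|j g h _ IHg _ IHh k ek].
- rewrite {k}ej DM; apply: mpow_add; first by apply: mpow_mull.
  case: j mh IH => [|j] mh IH; first exact: mpow_all.
  by apply: mpow_step => //; apply: IH.
- by rewrite D0; apply: mpow_zero.
- by rewrite DD; apply: mpow_add; [apply: IHg|apply: IHh].
Qed.

Variables (s : nat) (i0 : 'I_n) (a b : 'I_s -> 'I_n).
Hypothesis hab : pair_partition i0 a b.

(* The coefficient of [dx_j] in [dy_i0 + \sum_k y_(a k) dy_(b k)]. *)
Definition contact_coef (y : 'I_n -> O) (j : 'I_n) : O :=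
  D j (y i0) + \sum_k y (a k) * D j (y (b k)).

(** The error is expanded in the [dy_i]; its [dy_i0] part goes into the unit, and the substitution
    of the pairs absorbs the rest up to a term quadratic in the error. *)
Lemma newton_step k (om h y : 'I_n -> O) f : (1 < k)%N -> invertible f ->
    (forall j, om j = f * (contact_coef y j + h j)) ->
    (forall j, mpow eps k (h j)) ->
    (\matrix_(i, j) eps (D j (y i))) \in unitmx ->
  exists (h' y' : 'I_n -> O) f',
    [/\ invertible f', forall j, om j = f' * (contact_coef y' j + h' j),
        forall j, mpow eps k.+1 (h' j) & forall i, mpow eps 2 (y' i - y i)].
Proof.
move=> k1 [fi fK] omE mh.
pose J := \matrix_(i, j) D j (y i).
rewrite (_ : (\matrix_(i, j) _) = map_mx eps J); last by apply/matrixP => i j; rewrite !mxE.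
case/(local_mxinv epsZ nilp) => J' [JJ' J'J].
(* The coefficients of the error in the [dy_i], a basis because the Jacobian is invertible at the
   point and hence over [O]. *)
pose g i := \sum_j h j * J' j i.
have mg i : mpow eps k (g i) by apply: mpow_sum => j; rewrite mulrC; apply: mpow_mull.
have gE j : h j = g i0 * D j (y i0)
    + \sum_k (g (a k) * D j (y (a k)) + g (b k) * D j (y (b k))).
  rewrite -(big_pair hab (fun i => g i * D j (y i))).
  have /matrixP /(_ 0 j) : (\row_j h j) *m J' *m J = \row_j h j by rewrite -mulmxA J'J mulmx1.
  rewrite [RHS]mxE => <-; rewrite mxE; apply: eq_bigr => i _.
  by rewrite !mxE; congr (_ * _); apply: eq_bigr => l _; rewrite mxE.
(* The new unit is [f * (1 + g i0)]; [q] divides it out of the remaining coefficients. *)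
have [q qK] : invertible (1 + g i0).
  apply: (local_unit epsZ nilp); rewrite rmorphD rmorph1.
  have /mpow1P -> : mpow eps 1 (g i0) by apply: mpow_le (mg _); apply: ltnW.
  by rewrite addr0 oner_neq0.
(* Factoring out [1 + g i0] also rescales the terms [y_a dy_b]; the summand [- g i0 * y (a l)]
   compensates for this. *)
pose Ha l := q * g (a l); pose Hb l := q * (g (b l) - g i0 * y (a l)).
have mHa l : mpow eps k (Ha l) by apply: mpow_mull.
have mHb l : mpow eps k (Hb l).
  by apply: mpow_mull; apply: mpow_sub => //; rewrite mulrC; apply: mpow_mull.
exists (fun j => \sum_l Hb l * D j (Ha l)),
  (pair_glue a b (y i0 + \sum_l y (a l) * Ha l) (fun l => y (a l) + Hb l)
     (fun l => y (b l) - Ha l)), (f * (1 + g i0)).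
split.
- by exists (fi * q); rewrite mulrACA fK qK mulr1.
- move=> j; rewrite omE -mulrA; congr (_ * _).
  rewrite /contact_coef (pair_glue0 hab) DD Dsum gE.
  rewrite -!addrA [X in _ + X = _]addrCA -!big_split /= mulrDr mulr_sumr mulrDl mul1r.
  rewrite addrA; congr (_ + _); apply: eq_bigr => l _.
  rewrite (pair_gluel hab) (pair_gluer hab) DM DB.
  have HaE : (1 + g i0) * Ha l = g (a l) by rewrite mulrA qK mul1r.
  have HbE : (1 + g i0) * Hb l = g (b l) - g i0 * y (a l) by rewrite mulrA qK mul1r.
  rewrite [RHS](_ : _ = (1 + g i0) * Ha l * D j (y (a l))
    + ((1 + g i0) * Hb l + (1 + g i0) * y (a l)) * D j (y (b l))); last by ring.
  by rewrite HaE HbE; ring.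
(* The order is at least k + (k - 1), and this exceeds k because k > 1. *)
- move=> j; apply: mpow_sum => l.
  have : mpow eps (k + k.-1) (Hb l * D j (Ha l)).
    by apply: mpow_mul => //; apply: mpow_deriv; rewrite prednK // (ltn_trans _ k1).
  by apply: mpow_le; case: (k) k1 => [|[|k']] //= _; rewrite addnS ltnS leq_addr.
- have m2 u : mpow eps k u -> mpow eps 2 u by apply: mpow_le.
  elim/(pair_ind hab) => [|l|l].
  + rewrite (pair_glue0 hab) addrC addKr; apply: mpow_sum => l.
    by apply: mpow_mull; apply: m2.
  + by rewrite (pair_gluel hab) addrC addKr; apply: m2.
  + by rewrite (pair_gluer hab) addrC addKr; apply: mpow_opp; apply: m2.
Qed.

Lemma newton_iter (om h y : 'I_n -> O) f : invertible f ->
    (forall j, om j = f * (contact_coef y j + h j)) ->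
    (forall j, mpow eps 2 (h j)) ->
    (\matrix_(i, j) eps (D j (y i))) \in unitmx ->
  exists (y' : 'I_n -> O) f',
    [/\ invertible f', forall j, om j = f' * contact_coef y' j
      & forall i, mpow eps 2 (y' i - y i)].
Proof.
move=> fi omE mh uJ; have [N hN] := nilp.
(* With [N.+2] in place of [N] the base case is exactly the given error of order two; order [N]
   already forces it to be zero. *)
suff [h' [y' [f' [fi' omE' mh' yy']]]] : exists (h' y' : 'I_n -> O) f',
    [/\ invertible f', forall j, om j = f' * (contact_coef y' j + h' j),
        forall j, mpow eps N.+2 (h' j) & forall i, mpow eps 2 (y' i - y i)].
  exists y', f'; split=> // j; rewrite omE' (hN (h' j)) ?addr0 //.
  by apply: mpow_le (mh' j); rewrite leqW.
elim: N {hN} => [|N [h' [y' [f' [fi' omE' mh' yy']]]]].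
  exists h, y, f; split=> // i; rewrite subrr; exact: mpow_zero.
(* A correction of order two leaves the Jacobian at the point unchanged, so the next step is again
   possible. *)
have uJ' : (\matrix_(i, j) eps (D j (y' i))) \in unitmx.
  rewrite (_ : (\matrix_(i, j) _) = \matrix_(i, j) eps (D j (y i))) //.
  apply/matrixP => i j; rewrite !mxE; apply/eqP; rewrite -subr_eq0 -rmorphB -DB.
  by apply/eqP/mpow1P; apply: mpow_deriv.
have [] := newton_step _ fi' omE' mh' uJ'; first by [].
move=> h2 [y2 [f2 [fi2 omE2 mh2 yy2]]]; exists h2, y2, f2; split=> // i.
by rewrite -(subrK (y' i) (y2 i)) -addrA; apply: mpow_add.
Qed.

Hypothesis twoK : (2%:R : K) != 0.

Let lin (M : 'M[K]_n) i := \sum_j M i j *: X j.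

Let D_lin (M : 'M[K]_n) i j : D j (lin M i) = (M i j)%:A.
Proof.
rewrite Dsum (bigD1 j) //= DZ DX eqxx big1 ?addr0 // => l lj.
by rewrite DZ DX eq_sym (negPf lj) scaler0.
Qed.

(** The rows of [M] prescribe the linear parts of the new coordinates. A unit removes the term with
    [e], a correction of [y_i0] makes the error of order two, and the iteration takes over. *)
Lemma contact_normal_form (M : 'M[K]_n) (e : 'I_n -> K) (om : 'I_n -> O) :
    M \in unitmx -> (forall j, eps (om j) = M i0 j) ->
    (forall i j, eps (D i (om j) - D j (om i)) =
       \sum_k (M (a k) i * M (b k) j - M (a k) j * M (b k) i)
       + (M i0 i * e j - M i0 j * e i)) ->
  exists (y : 'I_n -> O) f,
    [/\ invertible f, forall j, om j = f * contact_coef y j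
      & forall i, mpow eps 2 (y i - \sum_j M i j *: X j)].
Proof.
move=> uM om0 dom0.
(* The differential of [E] at the point is [e], so multiplying by [1 + E] subtracts the wedge of row
   [i0] with [e] from the curl. *)
pose E := \sum_j e j *: X j.
have E0 : eps E = 0.
  by rewrite rmorph_sum big1 // => j _; rewrite epsZ X0 mulr0.
have [q qK] : invertible (1 + E).
  by apply: (local_unit epsZ nilp); rewrite rmorphD rmorph1 E0 addr0 oner_neq0.
have DE i : D i E = (e i)%:A.
  rewrite Dsum (bigD1 i) //= DZ DX eqxx big1 ?addr0 // => l li.
  by rewrite DZ DX eq_sym (negPf li) scaler0.
have lin0 i : eps (lin M i) = 0.
  by rewrite rmorph_sum big1 // => j _; rewrite epsZ X0 mulr0.
pose om' j := (1 + E) * om j.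
pose r j := om' j - ((M i0 j)%:A + \sum_k lin M (a k) * (M (b k) j)%:A).
have r0 j : eps (r j) = 0.
  rewrite rmorphB rmorphM rmorphD rmorph1 E0 addr0 mul1r om0 rmorphD (eps_scalar epsZ).
  rewrite rmorph_sum big1 ?addr0 ?subrr // => k _.
  by rewrite rmorphM lin0 mul0r.
have D1 i : D i 1 = 0 by exact: drv1 (DM i).
have Dc c i : D i (c%:A) = 0 by exact: drv_scalar (DL i) (DM i) c.
pose S i j := eps (D i (r j)).
have SE i j : S i j = eps (D i (om j)) + e i * M i0 j - \sum_k M (a k) i * M (b k) j.
  rewrite /S /r DB DM DD D1 DE add0r !(rmorphB, rmorphD, rmorphM).
  rewrite /= !(eps_scalar epsZ) E0 rmorph1 addr0 mul1r om0 DD Dc add0r Dsum rmorph_sum.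
  rewrite [e i * _ + _]addrC; congr (_ - _); apply: eq_bigr => k _.
  by rewrite DM D_lin Dc mulr0 addr0 rmorphM /= !(eps_scalar epsZ).
(* The curls of [om'] and of the linear model agree at the point, so the Jacobian of their
   difference [r] is symmetric there. *)
have Ssym i j : S i j = S j i.
  apply/eqP; rewrite -subr_eq0 !SE.
  have -> : eps (D i (om j)) = eps (D j (om i)) + (\sum_k (M (a k) i * M (b k) j
      - M (a k) j * M (b k) i) + (M i0 i * e j - M i0 j * e i)).
    by rewrite -dom0 rmorphB /= addrC subrK.
  by rewrite sumrB; apply/eqP; ring.
(* A potential of [r] modulo order two. Half the quadratic form of [S] would not do: an [r i] may
   contain a term such as x^(p), whose derivatives vanish at the point although it need not lie in m
   ^ 2. The products [r i * X i] take care of such terms. *)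
pose u := \sum_i r i * X i - 2%:R^-1 *: \sum_i \sum_j S i j *: (X i * X j).
have Du j : D j u = r j + \sum_i (D j (r i) - (S i j)%:A) * X i.
  rewrite DB DZ !Dsum.
  have -> : \sum_i D j (r i * X i) = \sum_i D j (r i) * X i + r j.
    rewrite (eq_bigr (fun i => D j (r i) * X i + r i * (j == i)%:R)); last first.
      by move=> i _; rewrite DM DX.
    rewrite big_split /= [X in _ + X](bigD1 j) //= eqxx mulr1 [X in _ + (_ + X)]big1 ?addr0 //.
    by move=> i ij; rewrite eq_sym (negPf ij) mulr0.
  have -> : \sum_i D j (\sum_l S i l *: (X i * X l)) = 2%:R *: \sum_i (S i j)%:A * X i.
    have h1 i : D j (\sum_l S i l *: (X i * X l)) =
        \sum_l S i l *: ((j == i)%:R * X l) + (S i j)%:A * X i.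
      rewrite Dsum (eq_bigr (fun l => S i l *: ((j == i)%:R * X l) + S i l *: (X i * (j == l)%:R)));
        last by move=> l _; rewrite DZ DM !DX scalerDr.
      rewrite big_split /=; congr (_ + _); rewrite (bigD1 j) //= eqxx mulr1 big1 ?addr0.
        by rewrite mulr_algl.
      by move=> l lj; rewrite eq_sym (negPf lj) mulr0 scaler0.
    rewrite (eq_bigr _ (fun i _ => h1 i)) big_split /= (bigD1 j) //= eqxx.
    rewrite [X in _ + X + _]big1 ?addr0; last first.
      move=> i ij; rewrite eq_sym (negPf ij) big1 // => l _.
      by rewrite mul0r scaler0.
    rewrite scaler_nat mulr2n; congr (_ + _); apply: eq_bigr => l _.
    by rewrite mul1r mulr_algl Ssym.
  rewrite scalerA mulVf // scale1r (eq_bigr _ (fun i _ => mulrBl _ _ _)) sumrB.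
  by rewrite addrAC addrC.
have mu : mpow eps 2 u.
  have mX i : mpow eps 1 (X i) by apply/mpow1P.
  apply: mpow_sub; first by apply: mpow_sum => i; apply: (@mpow_mul _ _ _ 1 1) => //; apply/mpow1P.
  apply: mpow_scale; do 2!apply: mpow_sum => ?; apply: mpow_scale.
  exact: (@mpow_mul _ _ _ 1 1).
pose y i := if i == i0 then lin M i0 + u else lin M i.
have y_lin i : mpow eps 2 (y i - lin M i).
  rewrite /y; case: eqP => [->|_]; first by rewrite addrC addKr.
  by rewrite subrr; apply: mpow_zero.
have [] := @newton_iter om (fun j => r j - D j u) y q.
- by exists (1 + E); rewrite mulrC.
- move=> j; rewrite (_ : om j = q * om' j); last by rewrite mulrA (mulrC q) qK mul1r.
  congr (_ * _); rewrite /contact_coef {1}/y eqxx DD D_lin.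
  rewrite (eq_bigr (fun k => lin M (a k) * (M (b k) j)%:A)); last first.
    move=> k _; rewrite /y.
    have [/negPf -> /negPf ->] := pair_notin hab k.
    by rewrite D_lin.
  by rewrite /r; ring.
- move=> j; rewrite Du opprD addrA subrr sub0r; apply: mpow_opp; apply: mpow_sum => i.
  apply: (@mpow_mul _ _ _ 1 1); apply/mpow1P => //.
  by rewrite rmorphB (eps_scalar epsZ) Ssym subrr.
- rewrite (_ : (\matrix_(i, j) _) = M) //; apply/matrixP => i j; rewrite mxE.
  rewrite -[RHS](eps_scalar epsZ) -D_lin; apply/eqP; rewrite -subr_eq0 -rmorphB -DB.
  by apply/eqP/mpow1P; apply: mpow_deriv; apply: y_lin.
move=> y' [f' [fi' omE yy']]; exists y', f'; split=> // i.
by rewrite -(subrK (y i) (y' i)) -addrA; apply: mpow_add.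
Qed.

End ContactNormalForm.

(** * Symplectic bases compatible with a flag *)

Section PairsOfList.
Variable n : nat.
Implicit Type L : seq ('I_n * 'I_n).

Definition pair_support L : seq 'I_n := flatten [seq [:: q.1; q.2] | q <- L].

Lemma mem_pair_support L q i :
  q \in L -> i \in [set q.1; q.2] -> i \in pair_support L.
Proof.
move=> qL iq; apply/flattenP; exists [:: q.1; q.2]; first by apply/mapP; exists q.
by move: iq; rewrite !inE.
Qed.

Lemma pair_support_disjoint L k l (q0 : 'I_n * 'I_n) i :
    uniq (pair_support L) -> (k < l < size L)%N ->
    i \in [set (nth q0 L k).1; (nth q0 L k).2] ->
  i \notin [set (nth q0 L l).1; (nth q0 L l).2].
Proof.
elim: L k l => [|q L IH] [|k] [|l] //=; rewrite ?ltn0 ?andbF //; last first.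
  by rewrite inE negb_or => /and3P[_ _ /IH]; apply.
rewrite !inE negb_or => /and3P[/andP[_ q1] q2 _] lL iq.
apply/negP => il; have : i \in pair_support L.
  by apply: (mem_pair_support (mem_nth q0 lL)); rewrite !inE.
by apply/negP; case/orP: iq => /eqP ->.
Qed.

(** The elimination below grows a list of pairs one at a time; this turns its final list into the
    indexed families of the statement. *)
Lemma pair_partition_of_list i0 L :
    uniq (i0 :: pair_support L) -> (forall i, i \in i0 :: pair_support L) ->
  pair_partition i0 (fun k : 'I_(size L) => (tnth (in_tuple L) k).1)
                    (fun k : 'I_(size L) => (tnth (in_tuple L) k).2).
Proof.
move=> /= /andP[i0L uL] cL; split.
- move=> [k kL]; rewrite (tnth_nth (i0, i0)) /=.
  elim: L uL k kL {i0L cL} => [|q L IH] //=.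
  rewrite inE negb_or => /and3P[/andP[q12 _] _ /IH {}IH] [//|k].
  exact: IH.
- move=> k l kl; rewrite !(tnth_nth (i0, i0)) /=.
  wlog lkl : k l kl / (k < l)%N.
    move=> H; have [lkl|lkl|ekl] := ltngtP k l; first exact: H.
    + by rewrite disjoint_sym; apply: H => //; rewrite eq_sym.
    + by rewrite (val_inj ekl) eqxx in kl.
  rewrite disjoints_subset; apply/subsetP => i ik; rewrite in_setC.
  by apply: pair_support_disjoint ik => //; rewrite lkl /=.
- apply/setP => i; rewrite !inE; apply/bigcupP/idP => [[k _ ik]|ii0].
    apply: contraNneq i0L => <-.
    by apply: mem_pair_support ik; apply: mem_tnth.
  have /flattenP[r /mapP[q qL ->] iq] : i \in pair_support L.
    by have := cL i; rewrite inE (negPf ii0).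
  have /tnthP[k kq] : q \in in_tuple L by [].
  by exists k => //; rewrite -kq; move: iq; rewrite !inE.
Qed.

End PairsOfList.

Section FlagSymplecticBasis.
Variables (K : fieldType) (n : nat) (ht : 'I_n -> nat).
Variables (c : 'I_n -> K) (B : 'M[K]_n).
Hypothesis Balt : forall i, B i i = 0.
Hypothesis Bskew : forall i j, B j i = - B i j.
Hypothesis Bnondeg : forall v : 'I_n -> K, \sum_i v i * c i = 0 ->
  (forall w : 'I_n -> K, \sum_i w i * c i = 0 ->
     \sum_i \sum_j v i * B i j * w j = 0) -> forall i, v i = 0.

(** Row [i], read as a vector, lies in every term of the flag that contains the i-th basis
    vector. *)
Definition height_compatible (M : 'M[K]_n) :=
  forall i j, M i j != 0 -> (ht i <= ht j)%N.

Lemma unitmx_ker (T : 'M[K]_n) :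
  (forall v : 'rV_n, v *m T = 0 -> v = 0) -> T \in unitmx.
Proof.
move=> kT; rewrite -row_free_unit -kermx_eq0; apply/rowV0P => v /sub_kermxP.
exact: kT.
Qed.

Lemma sum_neq0 I (r : seq I) (P : pred I) (G : I -> K) :
  \sum_(i <- r | P i) G i != 0 -> exists i, G i != 0.
Proof.
move=> G0; apply: contra_notP (negP G0) => G0'; rewrite big1 // => i _.
by apply/eqP/negPn/negP => Gi; apply: G0'; exists i.
Qed.

Definition pair_form (L : seq ('I_n * 'I_n)) (M : 'M[K]_n) i j : K :=
  \sum_(q <- L) (M q.1 i * M q.2 j - M q.1 j * M q.2 i).

(** The invariant of the elimination: [R] holds the indices not yet paired, and [be] is the matrix,
    with respect to the rows of [M], of what is left of [B] once the pairs in [L] and the wedge of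
    [c] with [e] are removed. *)
Definition partial_reduction (i0 : 'I_n) (e : 'I_n -> K) (R : {set 'I_n})
    (L : seq ('I_n * 'I_n)) (M be : 'M[K]_n) : Prop :=
  [/\ uniq (i0 :: pair_support L),
      forall i, (i \in R) = (i \notin i0 :: pair_support L),
      [/\ M \in unitmx, height_compatible M & forall j, M i0 j = c j],
      [/\ forall k, be k k = 0, forall k l, be l k = - be k l
        & forall k l, k \notin R -> be k l = 0]
    & forall i j, B i j = pair_form L M i j
        + \sum_k \sum_l M k i * be k l * M l j + (c i * e j - c j * e i)].

(** If row [k] of [be] were zero, the vector dual to row [k] of [M] would be killed by [c] and
    orthogonal to the kernel of [c], against nondegeneracy. *)
Lemma reduction_pivot i0 e R L M be k : partial_reduction i0 e R L M be ->
  k \in R -> exists l, be k l != 0.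
Proof.
move=> [uL RL [uM hM Mi0] [be0 beS beR] BE] kR.
apply: contrapT => nl.
have bek l : be k l = 0 by apply/eqP/negPn/negP => h; apply: nl; exists l.
pose v i := (invmx M) i k.
have Mv l : \sum_i M l i * v i = (l == k)%:R.
  by have /matrixP/(_ l k) := mulmxV uM; rewrite !mxE.
have vc : \sum_i v i * c i = 0.
  have := Mv i0; rewrite (_ : i0 == k = false); last first.
    by apply: contraTF kR => /eqP <-; rewrite RL inE eqxx.
  by rewrite mulr0n => h; rewrite -[RHS]h; apply: eq_bigr => i _; rewrite Mi0 mulrC.
have v0 : forall i, v i = 0.
  apply: Bnondeg => // w wc; pose d (f : 'I_n -> K) (u : 'I_n -> K) := \sum_i f i * u i.
  have bil (f g : 'I_n -> K) :
      \sum_i \sum_j v i * (f i * g j) * w j = d f v * d g w.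
    rewrite /d mulr_suml; apply: eq_bigr => i _; rewrite mulr_sumr.
    by apply: eq_bigr => j _; ring.
  have -> : \sum_i \sum_j v i * B i j * w j =
      \sum_(q <- L) (d (M q.1) v * d (M q.2) w - d (M q.2) v * d (M q.1) w)
      + \sum_k \sum_l be k l * (d (M k) v * d (M l) w)
      + (d c v * d e w - d e v * d c w).
    transitivity (\sum_i \sum_j (\sum_(q <- L) (v i * (M q.1 i * M q.2 j) * w j
           - v i * (M q.2 i * M q.1 j) * w j)
        + \sum_k \sum_l be k l * (v i * (M k i * M l j) * w j)
        + (v i * (c i * e j) * w j - v i * (e i * c j) * w j))).
      apply: eq_bigr => i _; apply: eq_bigr => j _; rewrite BE !(mulrDr, mulrDl).
      congr (_ + _ + _); last by ring.
        rewrite mulr_sumr mulr_suml; apply: eq_bigr => q _; ring.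
      rewrite mulr_sumr mulr_suml; apply: eq_bigr => r _.
      rewrite mulr_sumr mulr_suml; apply: eq_bigr => l _; ring.
    under eq_bigr do rewrite !big_split /=.
    rewrite [LHS]big_split [X in X + _ = _]big_split /=; congr (_ + _ + _).
    - under eq_bigr do rewrite exchange_big /=.
      rewrite exchange_big /=; apply: eq_bigr => q _.
      under eq_bigr do rewrite sumrB.
      by rewrite sumrB !bil.
    - under eq_bigr do rewrite exchange_big /=.
      rewrite exchange_big /=; apply: eq_bigr => r _.
      under eq_bigr do rewrite exchange_big /=.
      rewrite exchange_big /=; apply: eq_bigr => l _.
      under eq_bigr do rewrite -mulr_sumr.
      by rewrite -mulr_sumr bil.
    - rewrite big_split /= -!bil; congr (_ + _); rewrite -sumrN.
      by apply: eq_bigr => i _; rewrite sumrN.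
  have dMv l : d (M l) v = (l == k)%:R by rewrite -Mv; apply: eq_bigr => i _.
  have dc u : \sum_i u i * c i = 0 -> d c u = 0.
    by move=> <-; apply: eq_bigr => i _; rewrite mulrC.
  rewrite !dc // mul0r mulr0 subrr addr0 big_seq big1 ?add0r; last first.
    move=> q qL; rewrite !dMv.
    have kq : k \notin [set q.1; q.2].
      apply: contraTN kR => kq; rewrite RL negbK inE; apply/orP; right.
      exact: mem_pair_support kq.
    move: kq; rewrite !inE negb_or ![k == _]eq_sym => /andP[/negPf -> /negPf ->].
    by rewrite !mul0r subrr.
  rewrite big1 // => r _; rewrite big1 // => l _; rewrite dMv.
  by case: eqP => [->|_]; rewrite ?bek mul0r ?mulr0.
have := Mv k; rewrite eqxx big1 => [/esym/eqP|i _]; last by rewrite v0 mulr0.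
by rewrite oner_eq0.
Qed.

(** The new row [p] combines rows indexed by [R], and the new row [q] combines rows [k] with
    [be p k] nonzero. Taking [p], then [q], of minimal height in these two sets keeps the matrix
    height compatible. *)
Lemma reduction_step i0 e R L M be : partial_reduction i0 e R L M be ->
    R != set0 ->
  exists R' L' M' be', partial_reduction i0 e R' L' M' be' /\ R' \proper R.
Proof.
move=> red /set0Pn[r rR]; have piv := reduction_pivot red.
have [uL RL [uM hM Mi0] [be0 beS beR] BE] := red.
case: (arg_minnP ht rR) => p pR pmin.
have [l0 hl0] := piv p pR.
case: (@arg_minnP _ l0 (fun l => be p l != 0) ht hl0) => q bepq qmin.
have qp : q != p by apply: contraNneq bepq => ->; rewrite be0.
have qR : q \in R.
  by apply: contraTT bepq => qR; rewrite negbK beS beR ?oppr0.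
(* With [u = \sum_l be p l M_l] and [v = \sum_k ga k M_k], the form minus [v ^ u]
   no longer involves [p] and [q]. *)
pose ga k := be k q / be p q.
pose be' : 'M[K]_n := \matrix_(k, l) (be k l - ga k * be p l + be p k * ga l).
pose T : 'M[K]_n :=
  \matrix_(k, l) (if k == p then ga l else if k == q then be p l else (k == l)%:R).
pose M' := T *m M.
have gap : ga p = 1 by rewrite /ga divff.
have gaq : ga q = 0 by rewrite /ga be0 mul0r.
have M'p j : M' p j = \sum_k ga k * M k j.
  by rewrite mxE; apply: eq_bigr => k _; rewrite mxE eqxx.
have M'q j : M' q j = \sum_k be p k * M k j.
  by rewrite mxE; apply: eq_bigr => k _; rewrite mxE (negPf qp) eqxx.
have M'k k j : k != p -> k != q -> M' k j = M k j.
  move=> kp kq; rewrite mxE (bigD1 k) //= mxE (negPf kp) (negPf kq) eqxx mul1r.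
  rewrite big1 ?addr0 // => l lk; rewrite mxE (negPf kp) (negPf kq) eq_sym (negPf lk).
  by rewrite mul0r.
have be'S k l : be' l k = - be' k l by rewrite !mxE (beS k l); ring.
have be'R k l : k \notin R :\ p :\ q -> be' k l = 0.
  rewrite mxE !inE !negb_and !negbK => /or3P[/eqP->|/eqP->|kR].
  - by rewrite gaq mul0r subr0 /ga mulrCA divff // mulr1 (beS q l) subrr.
  - by rewrite gap mul1r subrr be0 mul0r addr0.
  - by rewrite /ga (beS k p) !(beR _ _ kR) oppr0 !mul0r subrr addr0.
exists (R :\ p :\ q), ((p, q) :: L), M', be'; split; last first.
  apply/properP; split; first by apply/subsetP => i; rewrite !inE => /and3P[].
  by exists q; rewrite // !inE eqxx.
have pNL : p \notin i0 :: pair_support L by rewrite -RL.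
have qNL : q \notin i0 :: pair_support L by rewrite -RL.
have i0p : i0 != p by apply: contraNneq pNL => <-; rewrite inE eqxx.
have i0q : i0 != q by apply: contraNneq qNL => <-; rewrite inE eqxx.
split.
- move: uL pNL qNL; rewrite /= !inE !negb_or => /andP[-> ->] /andP[_ ->] /andP[_ ->].
  by rewrite i0p i0q eq_sym qp.
- move=> i; rewrite !inE RL !inE !negb_or.
  by case: (i == p); case: (i == q); case: (i == i0).
- split.
  (* [T] differs from the identity only in rows [p] and [q], whose entries in columns [p] and [q]
     form the diagonal matrix with entries 1 and [be p q]. *)
  + rewrite unitmx_mul uM andbT; apply: unitmx_ker => v /rowP vT.
    have vTl l : v 0 p * ga l + v 0 q * be p l
        + (if (l != p) && (l != q) then v 0 l else 0) = 0.
      have := vT l; rewrite !mxE => h; rewrite -[RHS]h.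
      rewrite (bigD1 p) //= (bigD1 q) //= !mxE eqxx (negPf qp) eqxx addrA.
      congr (_ + _); case: ifP => [/andP[lp lq]|lpq].
        rewrite (bigD1 l) ?lp //= mxE (negPf lp) (negPf lq) eqxx mulr1 big1 ?addr0 //.
        move=> k /andP[/andP[kp kq] kl].
        by rewrite mxE (negPf kp) (negPf kq) (negPf kl) mulr0.
      rewrite big1 // => k /andP[kp kq]; rewrite mxE (negPf kp) (negPf kq).
      by case: eqP => [kl|]; rewrite ?mulr0 // -kl kp kq in lpq *.
    have vq : v 0 q = 0.
      have := vTl q; rewrite gaq mulr0 add0r eqxx andbF addr0 => /eqP.
      by rewrite mulf_eq0 (negPf bepq) orbF => /eqP.
    have vp : v 0 p = 0.
      by have := vTl p; rewrite vq gap mulr1 mul0r eqxx addr0 addr0.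
    apply/rowP => l; rewrite mxE.
    have := vTl l; rewrite vp vq !mul0r !add0r.
    have [->//|_] := eqVneq l p; have [->//|_] := eqVneq l q.
    by [].
  + move=> i j; have [->|ip] := eqVneq i p.
      rewrite M'p => /sum_neq0[k]; rewrite mulf_eq0 negb_or => /andP[gk /hM].
      apply: leq_trans; apply: pmin; apply: contraTT gk => kR.
      by rewrite negbK /ga beR ?mul0r.
    have [->|iq] := eqVneq i q; last by rewrite M'k //; apply: hM.
    rewrite M'q => /sum_neq0[k]; rewrite mulf_eq0 negb_or => /andP[bk /hM].
    by apply: leq_trans; apply: qmin.
  + by move=> j; rewrite M'k.
- split=> //; first by move=> k; rewrite mxE be0; ring.
- move=> i j; rewrite BE; congr (_ + _).
  rewrite /pair_form big_cons /= addrAC [RHS]addrC; congr (_ + _).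
    rewrite big_seq [RHS]big_seq; apply: eq_bigr => t tL.
    have tp k : k \in [set t.1; t.2] -> k != p /\ k != q.
      move=> kt; have kL := mem_pair_support tL kt.
      split; [apply: contraNneq pNL|apply: contraNneq qNL] => <-;
        by rewrite inE kL orbT.
    have [] := tp t.1; first by rewrite !inE eqxx.
    have [] := tp t.2; first by rewrite !inE eqxx orbT.
    by move=> *; rewrite !M'k.
  rewrite (eq_bigr (fun k => \sum_l (M' k i * be' k l * M' l j
     + (M k i * ga k * (be p l * M l j) - (be p k * M k i) * (ga l * M l j))))); last first.
    move=> k _; apply: eq_bigr => l _.
    have -> : M' k i * be' k l * M' l j = M k i * be' k l * M l j.
      have [kR|kR] := boolP (k \in R :\ p :\ q); last by rewrite be'R // !mulr0 !mul0r.
      have [lR|lR] := boolP (l \in R :\ p :\ q); last first.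
        by rewrite be'S be'R // oppr0 !mulr0 !mul0r.
      move: kR lR; rewrite !inE => /and3P[kq kp _] /and3P[lq lp _].
      by rewrite !M'k.
    by rewrite mxE; ring.
  rewrite (eq_bigr _ (fun k _ => big_split _ _ _ _ _)) big_split /= addrC; congr (_ + _).
  rewrite [M' p j * _]mulrC !M'p !M'q !mulr_suml -sumrB; apply: eq_bigr => k _.
  rewrite sumrB -!mulr_sumr; ring.
Qed.

Lemma flag_symplectic_basis : (exists i, c i != 0) ->
  exists s i0 (a b : 'I_s -> 'I_n) (M : 'M[K]_n) (e : 'I_n -> K),
    [/\ pair_partition i0 a b, M \in unitmx, height_compatible M,
        forall j, M i0 j = c j
      & forall i j, B i j = \sum_k (M (a k) i * M (b k) j - M (a k) j * M (b k) i)
                            + (M i0 i * e j - M i0 j * e i)].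
Proof.
case=> r cr; case: (@arg_minnP _ r (fun i => c i != 0) ht cr) => i0 ci0 imin.
(* This choice makes row [i0] of [B] minus the wedge of [c] with [e] vanish. *)
pose e j := B i0 j / c i0.
pose be : 'M[K]_n := \matrix_(k, l) (B k l - c k * e l + e k * c l).
pose M : 'M[K]_n := \matrix_(k, l) (if k == i0 then c l else (k == l)%:R).
have red0 : partial_reduction i0 e [set~ i0] [::] M be.
  split=> //.
  - by move=> i; rewrite !inE.
  - split.
    + apply: unitmx_ker => v /rowP vM.
      have vMl l : v 0 i0 * c l + (if l != i0 then v 0 l else 0) = 0.
        have := vM l; rewrite !mxE => h; rewrite -[RHS]h; rewrite (bigD1 i0) //= mxE eqxx.
        congr (_ + _); case: ifP => [li|/negbFE/eqP ->].
          rewrite (bigD1 l) //= mxE (negPf li) eqxx mulr1 big1 ?addr0 // => k /andP[ki kl].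
          by rewrite mxE (negPf ki) (negPf kl) mulr0.
        by rewrite big1 // => k ki; rewrite mxE (negPf ki) mulr0.
      have v0 : v 0 i0 = 0.
        have := vMl i0; rewrite eqxx addr0 => /eqP.
        by rewrite mulf_eq0 (negPf ci0) orbF => /eqP.
      apply/rowP => l; rewrite mxE; have := vMl l; rewrite v0 mul0r add0r.
      by have [->//|_] := eqVneq l i0.
    + move=> i j; rewrite mxE; have [->|_] := eqVneq i i0; first exact: imin.
      by have [->//|_] := eqVneq i j; rewrite eqxx.
    + by move=> j; rewrite mxE eqxx.
  - split.
    + by move=> k; rewrite mxE Balt; ring.
    + by move=> k l; rewrite !mxE (Bskew k l); ring.
    + move=> k l; rewrite !inE negbK => /eqP ->; rewrite mxE /e Balt mul0r mul0r addr0.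
      by rewrite mulrCA divff // mulr1 subrr.
  - have Mc k l i j : M k i * be k l * M l j = (k == i)%:R * be k l * (l == j)%:R.
      have b0 t : be i0 t = 0.
        rewrite mxE /e Balt mul0r mul0r addr0.
        by rewrite mulrCA divff // mulr1 subrr.
      have b1 t : be t i0 = 0.
        have -> : be t i0 = - be i0 t by rewrite !mxE (Bskew t i0); ring.
        by rewrite b0 oppr0.
      rewrite [M k i]mxE [M l j]mxE; have [->|_] := eqVneq k i0; first by rewrite b0 !mulr0 !mul0r.
      by have [->|_] := eqVneq l i0; rewrite ?b1 ?mulr0 ?mul0r.
    move=> i j; rewrite /pair_form big_nil add0r.
    rewrite (bigD1 i) //= [X in _ + X + _]big1 ?addr0; last first.
      by move=> k ki; rewrite big1 // => l _; rewrite Mc (negPf ki) !mul0r.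
    rewrite (bigD1 j) //= [X in _ + X + _]big1 ?addr0; last first.
      by move=> k kj; rewrite Mc (negPf kj) !mulr0.
    by rewrite Mc !eqxx !(mul1r, mulr1) mxE; ring.
suff [L [M' [be' [uL RL [uM hM Mi0] [_ _ beR] BE]]]] :
    exists L M' be', partial_reduction i0 e set0 L M' be'.
  exists (size L), i0, (fun k => (tnth (in_tuple L) k).1),
    (fun k => (tnth (in_tuple L) k).2), M', e; split=> //.
    apply: pair_partition_of_list => // i.
    by have := RL i; rewrite inE => /esym/negbFE.
  move=> i j; rewrite BE /pair_form big_tnth !Mi0 [X in _ + X + _]big1 ?addr0 //.
  by move=> k _; rewrite big1 // => l _; rewrite beR ?inE // mulr0 mul0r.
have [m] := ubnP #|[set~ i0]|.
elim: m [set~ i0] [::] M be red0 => // m IH R L M' be' red lt.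
have [R0|R0] := eqVneq R set0; first by exists L, M', be'; rewrite -R0.
have [R2 [L2 [M2 [be2 [red2 /proper_card lt2]]]]] := reduction_step red R0.
by apply: (IH R2 L2 M2 be2 red2); apply: leq_trans lt2 _.
Qed.

End FlagSymplecticBasis.

(** * Counting pairs by ranks *)

Section PairMatrix.
Variables (K : fieldType) (n s : nat) (i0 : 'I_n) (a b : 'I_s -> 'I_n).
Hypothesis hab : pair_partition i0 a b.

Definition pair_mx : 'M[K]_n := \matrix_(i, j)
  \sum_k ((a k == i)%:R * (b k == j)%:R - (a k == j)%:R * (b k == i)%:R).

Lemma pair_mx0 j : pair_mx i0 j = 0.
Proof.
rewrite mxE big1 // => k _; have [/negPf -> /negPf ->] := pair_notin hab k.
by rewrite mul0r mulr0 subrr.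
Qed.

Lemma pair_mxl l j : pair_mx (a l) j = (b l == j)%:R.
Proof.
rewrite mxE (bigD1 l) //= eqxx mul1r [b l == a l]eq_sym (negPf (pair_neq hab l l)).
rewrite mulr0 subr0 big1 ?addr0 // => k kl.
rewrite (inj_eq (pair_injl hab)) (negPf kl) [b k == a l]eq_sym.
by rewrite (negPf (pair_neq hab l k)) mul0r mulr0 subrr.
Qed.

Lemma pair_mxr l j : pair_mx (b l) j = - (a l == j)%:R.
Proof.
rewrite mxE (bigD1 l) //= eqxx mulr1 (negPf (pair_neq hab l l)) mul0r sub0r.
rewrite big1 ?addr0 // => k kl.
rewrite (inj_eq (pair_injr hab)) (negPf kl) (negPf (pair_neq hab k l)).
by rewrite mul0r mulr0 subrr.
Qed.

Lemma pair_mx_congr (N : 'M[K]_n) i j : (N^T *m pair_mx *m N) i j =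
  \sum_k (N (a k) i * N (b k) j - N (a k) j * N (b k) i).
Proof.
rewrite -mulmxA mxE (big_pair hab) mxE [X in _ * X]mxE big1 => [|l _]; last first.
  by rewrite pair_mx0 mul0r.
rewrite mulr0 add0r; apply: eq_bigr => k _; rewrite !mxE.
have h i1 (c : K) : \sum_l c * (i1 == l)%:R * N l j = c * N i1 j.
  rewrite (bigD1 i1) //= eqxx mulr1 big1 ?addr0 // => l li.
  by rewrite eq_sym (negPf li) mulr0 mul0r.
have -> : \sum_l pair_mx (a k) l * N l j = 1 * N (b k) j.
  by rewrite -h; apply: eq_bigr => l _; rewrite pair_mxl mul1r.
have -> : \sum_l pair_mx (b k) l * N l j = -1 * N (a k) j.
  by rewrite -h; apply: eq_bigr => l _; rewrite pair_mxr mulN1r.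
by ring.
Qed.

Variable ht : 'I_n -> nat.

(** Each pair is counted in both orientations, so this is the number of indices other than [i0] of
    height below [q] whose partner has height below [r]. *)
Definition pair_count q r : nat := \sum_k
  (((ht (a k) < q) && (ht (b k) < r)) + ((ht (b k) < q) && (ht (a k) < r)))%N.

Let partner := pair_glue a b i0 b a.

Definition pair_block q r : {set 'I_n} :=
  [set i | [&& i != i0, ht i < q & ht (partner i) < r]%N].

Lemma card_pair_block q r : #|pair_block q r| = pair_count q r.
Proof.
rewrite -sum1_card big_mkcond /= (big_pair hab) /= !inE eqxx /= add0r.
apply: eq_bigr => k _; have [ai bi] := pair_notin hab k.
rewrite !inE ai bi /partner (pair_gluel hab) (pair_gluer hab) /=.
by case: ifP; case: ifP.
Qed.

Definition pair_submx q r : 'M[K]_n :=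
  \matrix_(i, j) ((ht i < q)%N%:R * pair_mx i j * (ht j < r)%N%:R).

Definition block_selector q r : 'M[K]_(#|pair_block q r|, n) :=
  \matrix_(u, j) (enum_val u == j)%:R.

Lemma pair_submxE q r i j : pair_submx q r i j = (i \in pair_block q r)%:R * pair_mx i j.
Proof.
rewrite mxE inE; elim/(pair_ind hab): i => [|k|k].
- by rewrite pair_mx0 !mulr0 mul0r.
- rewrite (pair_notin hab k).1 /partner (pair_gluel hab) pair_mxl /=.
  by case: eqP => [->|_]; rewrite ?mulr0 ?mul0r // !mulr1 -natrM mulnb.
- rewrite (pair_notin hab k).2 /partner (pair_gluer hab) pair_mxr /=.
  by case: eqP => [->|_]; rewrite ?oppr0 ?mulr0 ?mul0r // -mulrA mulN1r !mulrN mulr1 -natrM mulnb.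
Qed.

(** Away from [i0] the matrix [pair_mx] is a signed permutation matrix. Truncation by heights keeps
    the rows of [pair_block] intact and clears all others, so the rank is the number of surviving
    rows. *)
Lemma pair_submx_rank q r : \rank (pair_submx q r) = pair_count q r.
Proof.
have SR u j : (block_selector q r *m pair_submx q r) u j = pair_submx q r (enum_val u) j.
  rewrite mxE (bigD1 (enum_val u)) //= [block_selector _ _ _ _]mxE eqxx mul1r.
  by rewrite big1 ?addr0 // => l lu; rewrite [block_selector _ _ _ _]mxE eq_sym (negPf lu) mul0r.
rewrite -card_pair_block; apply/eqP; rewrite eqn_leq; apply/andP; split.
  have -> : pair_submx q r = (block_selector q r)^T *m (block_selector q r *m pair_submx q r).
    apply/matrixP => i j; rewrite [RHS]mxE.
    rewrite (eq_bigr (fun u => (enum_val u == i)%:R * pair_submx q r (enum_val u) j)); last first.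
      by move=> u _; rewrite SR !mxE.
    have [iD|iD] := boolP (i \in pair_block q r); last first.
      rewrite pair_submxE (negPf iD) mul0r big1 // => u _.
      by case: eqP => [ui|_]; [rewrite -ui enum_valP in iD|rewrite mul0r].
    rewrite (bigD1 (enum_rank_in iD i)) //= enum_rankK_in // eqxx mul1r.
    rewrite big1 ?addr0 // => u ui; case: eqP => [uE|_]; last by rewrite mul0r.
    by case/eqP: ui; apply: etrans (esym (enum_valK_in iD u)) _; rewrite uE.
  by apply: leq_trans (mxrankM_maxl _ _) (rank_leq_col _).
(* The surviving rows are orthonormal up to sign conventions already matched by [pair_mx], so its
   transpose supplies a right inverse; this bounds the rank from below. *)
have one : block_selector q r *m pair_submx q r *m (pair_mx^T *m (block_selector q r)^T) = 1%:M.
  apply/matrixP => u v; rewrite [LHS]mxE [RHS]mxE.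
  have h i l : \sum_j pair_submx q r i j * pair_mx l j
      = (i \in pair_block q r)%:R * (i == l)%:R.
    under eq_bigr do rewrite pair_submxE -mulrA; rewrite -mulr_sumr.
    have [iD|_] := boolP (i \in _); last by rewrite !mul0r.
    rewrite !mul1r.
    have sgl (f : 'I_n -> K) i1 : \sum_j (i1 == j)%:R * f j = f i1.
      rewrite (bigD1 i1) //= eqxx mul1r big1 ?addr0 // => j ji.
      by rewrite eq_sym (negPf ji) mul0r.
    move: iD; rewrite inE => /and3P[+ _ _].
    elim/(pair_ind hab): i => [|k|k] ii0; first by rewrite eqxx in ii0.
      under eq_bigr do rewrite pair_mxl.
      rewrite (sgl (pair_mx l)); elim/(pair_ind hab): l => [|l|l].
      - by rewrite pair_mx0 (negPf ii0).
      - by rewrite pair_mxl !(inj_eq (pair_injl hab), inj_eq (pair_injr hab)) eq_sym.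
      - by rewrite pair_mxr !(negPf (pair_neq hab _ _)) oppr0.
    under eq_bigr do rewrite pair_mxr mulNr.
    rewrite sumrN (sgl (pair_mx l)); elim/(pair_ind hab): l => [|l|l].
    - by rewrite pair_mx0 (negPf ii0) oppr0.
    - by rewrite pair_mxl ![b _ == a _]eq_sym !(negPf (pair_neq hab _ _)) oppr0.
    - by rewrite pair_mxr opprK !(inj_eq (pair_injl hab), inj_eq (pair_injr hab)) eq_sym.
  transitivity (\sum_j pair_submx q r (enum_val u) j * pair_mx (enum_val v) j).
    apply: eq_bigr => j _; rewrite SR; congr (_ * _); rewrite mxE.
    rewrite (bigD1 (enum_val v)) //= [pair_mx^T _ _]mxE [(block_selector _ _)^T _ _]mxE.
    rewrite [block_selector _ _ _ _]mxE eqxx mulr1 big1 ?addr0 // => l lv.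
    by rewrite [(block_selector _ _)^T _ _]mxE [block_selector _ _ _ _]mxE eq_sym (negPf lv) mulr0.
  by rewrite h enum_valP mul1r (inj_eq enum_val_inj).
have := mxrank1 K #|pair_block q r|; rewrite -one => {1}<-.
by apply: leq_trans (mxrankM_maxl _ _) (mxrankM_maxr _ _).
Qed.

End PairMatrix.

(** If [N k i] is nonzero and [i] has height below [q], then so has [k]. Hence truncating the
    congruent matrix agrees with truncating the middle factor first, and ranks cannot grow under
    products. *)
Lemma pair_count_le (K : fieldType) n s s' (ht : 'I_n -> nat) i0 j0
    (a b : 'I_s -> 'I_n) (a' b' : 'I_s' -> 'I_n) (N : 'M[K]_n) lam :
    pair_partition i0 a b -> pair_partition j0 a' b' -> height_compatible ht N ->
    (forall i j, i != j0 -> j != j0 -> pair_mx K a' b' i j =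
       lam * \sum_k (N (a k) i * N (b k) j - N (a k) j * N (b k) i)) ->
  forall q r, (pair_count a' b' ht q r <= pair_count a b ht q r)%N.
Proof.
move=> hab hab' hN NE q r.
rewrite -(pair_submx_rank K hab') -(pair_submx_rank K hab).
(* The projection also removes [j0], where the relation [NE] is not given and [pair_mx] has zero row
   and column. *)
pose Q t : 'M[K]_n := diag_mx (\row_i ((ht i < t)%N && (i != j0))%:R).
have sub0 i : pair_mx K a' b' i j0 = 0.
  by elim/(pair_ind hab'): i => [|k|k]; rewrite ?(pair_mx0 K hab') ?(pair_mxl K hab')
    ?(pair_mxr K hab') ?(negPf (pair_notin hab' k).1) ?(negPf (pair_notin hab' k).2) ?oppr0.
have -> : pair_submx K a' b' ht q r =
    (lam *: (Q q *m N^T)) *m pair_submx K a b ht q r *m (N *m Q r).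
  apply/matrixP => i j.
  have QN t k l : (N *m Q t) k l = N k l * ((ht l < t)%N && (l != j0))%:R.
    by rewrite mul_mx_diag !mxE.
  have NQ t k l : ((lam *: (Q t *m N^T)) k l) = lam * (((ht k < t)%N && (k != j0))%:R * N l k).
    by rewrite mxE mul_diag_mx !mxE.
  have cut t k l : (ht l < t)%N -> (ht k < t)%N%:R * N k l = N k l.
    move=> lt; have [->|/hN kl] := eqVneq (N k l) 0; first by rewrite mulr0.
    by rewrite (leq_ltn_trans kl lt) mul1r.
  rewrite [LHS]mxE -mulmxA [RHS]mxE.
  have [->|ij0] := eqVneq i j0.
    rewrite (pair_mx0 K hab') mulr0 mul0r big1 // => k _.
    by rewrite NQ eqxx andbF mul0r mulr0 mul0r.
  have [->|jj0] := eqVneq j j0.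
    rewrite sub0 mulr0 mul0r big1 // => k _; rewrite [X in _ * X]mxE big1 ?mulr0 // => l _.
    by rewrite QN eqxx andbF !mulr0.
  rewrite NE // -(pair_mx_congr hab) -mulmxA [(N^T *m _) i j]mxE.
  have [iq|iq] := ltnP (ht i) q; last first.
    rewrite !mul0r big1 // => k _.
    by rewrite NQ ltnNge iq mul0r mulr0 mul0r.
  have [jr|jr] := ltnP (ht j) r; last first.
    rewrite mulr0 big1 // => k _; rewrite [X in _ * X]mxE big1 ?mulr0 // => l _.
    by rewrite QN ltnNge jr !mulr0.
  rewrite mul1r mulr1 mulr_sumr; apply: eq_bigr => k _; rewrite NQ iq ij0 mul1r mulrA mxE.
  rewrite -[in LHS](cut q k i iq) -!mulrA; congr (_ * _); rewrite mulrCA; congr (_ * _).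
  rewrite [X in _ * X = _]mxE [RHS]mxE mulr_sumr; apply: eq_bigr => l _.
  by rewrite QN jr jj0 mulr1 [pair_submx _ _ _ _ _ _ _ _]mxE -[in LHS](cut r l j jr); ring.
by apply: leq_trans (mxrankM_maxl _ _) (mxrankM_maxr _ _).
Qed.

(** * From equal counts to a permutation of the indices *)

Section PairPermutation.
Variables (n s : nat) (ht : 'I_n -> nat) (i0 j0 : 'I_n) (a b a' b' : 'I_s -> 'I_n).
Hypotheses (hab : pair_partition i0 a b) (hab' : pair_partition j0 a' b').
Hypothesis h0 : ht i0 = ht j0.
Hypothesis hcount : forall q r, pair_count a b ht q r = pair_count a' b' ht q r.

Let ty (c d : 'I_s -> 'I_n) k := (minn (ht (c k)) (ht (d k)), maxn (ht (c k)) (ht (d k))).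

(** A second difference of the counts isolates the pairs with prescribed heights; it is written
    additively to avoid truncated subtraction. *)
Lemma pair_type_count (c d : 'I_s -> 'I_n) q r :
  (pair_count c d ht q.+1 r.+1 + pair_count c d ht q r =
   pair_count c d ht q r.+1 + pair_count c d ht q.+1 r
   + \sum_k ((ht (c k) == q) && (ht (d k) == r) + (ht (d k) == q) && (ht (c k) == r)))%N.
Proof.
rewrite /pair_count -!big_split /=; apply: eq_bigr => k _.
move: (ht (c k)) (ht (d k)) => u v.
by case: (ltngtP u q); case: (ltngtP v q); case: (ltngtP u r); case: (ltngtP v r);
  rewrite ?ltnS; do ?[move=> ?]; lia.
Qed.

Lemma pair_type_perm : exists rho : {perm 'I_s}, forall k, ty a b k = ty a' b' (rho k).
Proof.
(* A pair of two equal heights matches in both orientations, whence the factor 2 when [q = r]. *)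
have cE (c d : 'I_s -> 'I_n) q r : (q <= r)%N ->
    (\sum_k ((ht (c k) == q) && (ht (d k) == r) + (ht (d k) == q) && (ht (c k) == r))
     = (q == r).+1 * count_mem (q, r) [seq ty c d k | k <- enum 'I_s])%N.
  move=> qr; rewrite count_map -sum1_count [in RHS]big_mkcond [in RHS]big_enum big_distrr /=.
  apply: eq_bigr => k _; rewrite /ty xpair_eqE.
  move: (ht (c k)) (ht (d k)) => u v.
  by case: (eqVneq q r) => [<-|qr']; case: ifP => /andP; lia.
have cntE q r : count_mem (q, r) [seq ty a b k | k <- enum 'I_s]
    = count_mem (q, r) [seq ty a' b' k | k <- enum 'I_s].
  have [qr|rq] := leqP q r; last first.
    have z (c d : 'I_s -> 'I_n) : count_mem (q, r) [seq ty c d k | k <- enum 'I_s] = 0%N.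
      apply/count_memPn; apply/mapP => -[k _ []]; lia.
    by rewrite !z.
  have := pair_type_count a b q r; have := pair_type_count a' b' q r.
  rewrite !hcount !cE // => -> /addnI /eqP; rewrite eqn_pmul2l // => /eqP.
  by [].
have pe : perm_eq [tuple ty a b k | k < s] [tuple ty a' b' k | k < s].
  by apply/allP => -[q r] _ /=; rewrite cntE.
have /tuple_permP[rho rhoE] := pe.
exists rho => k; have /(congr1 (fun t => nth (0, 0)%N t k)) := rhoE.
by rewrite -!tnth_nth !tnth_mktuple.
Qed.

Lemma pair_permutation : exists pi : {perm 'I_n},
  [/\ pi i0 = j0, forall k, exists l, [set pi (a k); pi (b k)] = [set a' l; b' l]
    & forall i, ht (pi i) = ht i].
Proof.
have [rho rhoE] := pair_type_perm.
(* [rho] matches only unordered types of heights. When the first members differ in height, the pair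
   has to be sent to its image crosswise. *)
pose same k := ht (a k) == ht (a' (rho k)).
pose fa k := if same k then a' (rho k) else b' (rho k).
pose fb k := if same k then b' (rho k) else a' (rho k).
pose f := pair_glue a b j0 fa fb.
have f0 : f i0 = j0 by rewrite /f (pair_glue0 hab).
have fA k : f (a k) = fa k by rewrite /f (pair_gluel hab).
have fB k : f (b k) = fb k by rewrite /f (pair_gluer hab).
have fset k : [set fa k; fb k] = [set a' (rho k); b' (rho k)].
  by rewrite /fa /fb; case: (same k) => //; rewrite setUC.
have fht k : ht (fa k) = ht (a k) /\ ht (fb k) = ht (b k).
  have [] := rhoE k; rewrite /fa /fb /same.
  by case: eqP => [<-|]; lia.
have fsurj j : exists i, f i = j.
  elim/(pair_ind hab'): j => [|l|l]; first by exists i0.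
    have : a' l \in [set fa (rho^-1 l)%g; fb (rho^-1 l)%g].
      by rewrite fset permKV !inE eqxx.
    by rewrite !inE => /orP[]/eqP ->; [exists (a (rho^-1 l)%g)|exists (b (rho^-1 l)%g)].
  have : b' l \in [set fa (rho^-1 l)%g; fb (rho^-1 l)%g].
    by rewrite fset permKV !inE eqxx orbT.
  by rewrite !inE => /orP[]/eqP ->; [exists (a (rho^-1 l)%g)|exists (b (rho^-1 l)%g)].
(* A section of the surjection [f] is injective, hence a permutation of the finite index set, and
   its inverse is [f]. *)
pose g j := projT1 (cid (fsurj j)).
have gK : cancel g f by move=> j; apply: (projT2 (cid (fsurj j))).
have piE i : ((perm (can_inj gK))^-1)%g i = f i.
  set rho' := perm (can_inj gK); rewrite -{1}(permKV rho' i) -[X in f X](permKV rho' i).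
  by rewrite permK [in RHS]permE gK.
exists (perm (can_inj gK))^-1%g; split.
- by rewrite piE.
- by move=> k; exists (rho k); rewrite !piE fA fB fset.
- move=> i; rewrite piE; elim/(pair_ind hab): i => [|k|k]; first by rewrite f0.
    by rewrite fA; case: (fht k).
  by rewrite fB; case: (fht k).
Qed.

End PairPermutation.

(** * Divided power algebras *)

Section FlagInclusion.
Variables (K : fieldType) (p : nat) (E : vectType K) (F : nat -> {vspace E}).
Variables (A : comAlgType K) (dp : E -> nat -> A).
Definition flag_incl : flag_algebra p F dp -> A := \val.
HB.instance Definition _ := GRing.RMorphism.copy flag_incl (\val : flag_algebra p F dp -> A).
HB.instance Definition _ := GRing.Linear.copy flag_incl (\val : flag_algebra p F dp -> A).
End FlagInclusion.

(** An alias of the product, so that it can carry the multiplication with square-zero second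
    component instead of the componentwise one. *)
Definition dual_number (A : Type) : Type := (A * A)%type.

Section DualNumbers.
Variables (K : fieldType) (A : comAlgType K).
HB.instance Definition _ := GRing.Lmodule.copy (dual_number A) (A * A)%type.
Implicit Types u v w : dual_number A.

Definition dual_one : dual_number A := (1, 0).
Definition dual_mul u v : dual_number A := (u.1 * v.1, u.1 * v.2 + u.2 * v.1).

Lemma dual_mulA : associative dual_mul.
Proof. by move=> u v w; rewrite /dual_mul; congr (_, _); rewrite /=; ring. Qed.
Lemma dual_mulC : commutative dual_mul.
Proof. by move=> u v; rewrite /dual_mul; congr (_, _); rewrite /=; ring. Qed.
Lemma dual_mul1 : left_id dual_one dual_mul.
Proof. by case=> u v; rewrite /dual_mul /dual_one /=; congr (_, _); ring. Qed.
Lemma dual_mulDl : left_distributive dual_mul +%R.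
Proof. by move=> [u u'] [v v'] [w w']; apply: injective_projections; rewrite /=; ring. Qed.
Lemma dual_one_neq0 : dual_one != 0.
Proof. by apply/eqP => -[/eqP]; rewrite oner_eq0. Qed.
HB.instance Definition _ := GRing.Zmodule_isComNzRing.Build (dual_number A)
  dual_mulA dual_mulC dual_mul1 dual_mulDl dual_one_neq0.

Lemma dual_scaleAl (c : K) u v : c *: (u * v) = (c *: u : dual_number A) * v.
Proof.
by case: u v => [u u'] [v v']; apply: injective_projections; rewrite /= ?scalerDr ?scalerAl.
Qed.
HB.instance Definition _ := GRing.Lmodule_isLalgebra.Build K (dual_number A) dual_scaleAl.
HB.instance Definition _ := GRing.Lalgebra_isComAlgebra.Build K (dual_number A).

End DualNumbers.

Section DividedPowerAlgebra.
Variables (K : fieldType) (E : vectType K) (A : comAlgType K) (dp : E -> nat -> A).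
Hypothesis hA : is_divpow_algebra dp.

(** The universal property maps [A] to the subalgebra generated by the divided powers; followed by
    the inclusion this is the identity, by uniqueness. *)
Lemma divpow_generated (B : A -> Prop) :
  (forall v r, B (dp v r)) -> B 1 ->
  (forall c g h, B g -> B h -> B (c *: g + h)) ->
  (forall g h, B g -> B h -> B (g * h)) -> forall f, B f.
Proof.
move=> Bdp B1 BL BM f; have [[r0 rD rZ rM] ex uni] := hA.
pose S := flag_algebra 2 (fun _ : nat => fullv : {vspace E}) dp.
have inS v r : dp v r \in flag_pred 2 (fun _ : nat => fullv : {vspace E}) dp.
  apply/flag_predP => C SC _ _ _; apply: SC; exists r, v, r; split=> //.
    exact: memvf.
  exact: ltnW (ltn_expl r.+1 (isT : 1 < 2)%N).
pose dpS v r : S := FlagAlgebra (inS v r).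
have relS : divpow_relations dpS.
  split=> [v|u v r|c v r|v r s]; apply: val_inj; rewrite [LHS]/=.
  - by rewrite r0 rmorph1.
  - by rewrite rD rmorph_sum; apply: eq_bigr => i _; rewrite rmorphM.
  - by rewrite rZ linearZ.
  - by rewrite rM rmorphM rmorph_nat.
have [phi phiE] := ex _ _ relS.
have H g : \val (phi g) = g.
  have := uni A (@flag_incl _ _ _ _ _ _ \o phi : {lrmorphism A -> A}) (idfun : {lrmorphism A -> A}).
  by apply=> v r /=; rewrite phiE.
rewrite -[f]H.
have /flag_predP := valP (phi f); apply=> //.
by move=> g [i [v [r [_ _ ->]]]]; apply: Bdp.
Qed.

Lemma divpow_augmentation : exists eps : {rmorphism A -> K},
  (forall c u, eps (c *: u) = c * eps u) /\ forall v r, eps (dp v r) = (r == 0)%:R.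
Proof.
have [_ ex _] := hA.
have [|phi phiE] := ex K^o (fun _ r => (r == 0)%:R : K^o).
  split=> //.
  - move=> _ _ r; rewrite big_ord_recl /= subn0 mul1r big1 ?addr0 // => i _.
    by rewrite mul0r.
  - by move=> c _ [|r]; rewrite ?expr0 ?scale1r ?scaler0.
  - move=> _ [|r] [|s]; rewrite ?mul0r ?mulr0 //= ?bin0 ?mulr1 //.
have phiZ c u : phi (c *: u) = c *: phi u by rewrite linearZ.
by exists phi; split.
Qed.

(* A derivation of [A] amounts to a section of the dual numbers over [A], which
   is obtained from the universal property. *)
Lemma divpow_derivation (l : E -> K) : (forall u v, l (u + v) = l u + l v) ->
    (forall c v, l (c *: v) = c * l v) ->
  exists d : A -> A, [/\ linear d, forall f g, d (f * g) = d f * g + f * d g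
    & forall v r, d (dp v r) = if r is r'.+1 then l v *: dp v r' else 0].
Proof.
move=> lD lZ; have [[r0 rD rZ rM] ex uni] := hA.
pose dpB v r : dual_number A := (dp v r, if r is r'.+1 then l v *: dp v r' else 0).
have sum1 I (r : seq I) (P : pred I) (G : I -> dual_number A) :
    (\sum_(i <- r | P i) G i).1 = \sum_(i <- r | P i) (G i).1.
  by apply: (big_morph (fun u : dual_number A => u.1)).
have sum2 I (r : seq I) (P : pred I) (G : I -> dual_number A) :
    (\sum_(i <- r | P i) G i).2 = \sum_(i <- r | P i) (G i).2.
  by apply: (big_morph (fun u : dual_number A => u.2)).
have relB : divpow_relations dpB.
  split=> [v|u v r|c v r|v r s].
  - by rewrite /dpB r0.
  - rewrite [RHS]surjective_pairing sum1 sum2; congr (_, _); first exact: rD.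
    rewrite /= big_split /=; case: r => [|r].
      by rewrite !big_ord1 /= sub0n !(mulr0, mul0r, addr0).
    rewrite [X in _ = X + _]big_ord_recr /= subnn mulr0 addr0.
    rewrite [X in _ = _ + X]big_ord_recl /= mul0r add0r.
    rewrite lD scalerDl addrC; congr (_ + _).
      rewrite rD scaler_sumr; apply: eq_bigr => i _.
      by rewrite subSn -1?ltnS // scalerAr.
    rewrite rD scaler_sumr; apply: eq_bigr => i _.
    by rewrite /bump /= add1n subSS scalerAl.
  - congr (_, _); first exact: rZ.
    case: r => [|r] /=; first by rewrite scaler0.
    by rewrite rZ lZ !scalerA exprS mulrAC.
  - transitivity (('C(r + s, r)%:R : K) *: dpB v (r + s)%N); last first.
      by rewrite scaler_nat mulr_natl.
    congr (_, _); first by rewrite /= rM scaler_nat mulr_natl.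
    rewrite [LHS]/=; case: r => [|r]; [rewrite add0n|]; case: s => [|s]; rewrite ?addn0.
    + by rewrite !(mulr0, mul0r, addr0, scaler0).
    + by rewrite r0 mul1r mul0r addr0 bin0 scale1r.
    + by rewrite r0 mulr1 mulr0 add0r binn scale1r.
    + rewrite -scalerAr -scalerAl !rM addnS /= addSn addSnnS -scalerDr -mulrDl -natrD.
      by rewrite -binS !addnS mulr_natl scaler_nat scalerMnr.
have [phi phiE] := ex _ _ relB.
exists (fun f => (phi f).2).
have phi1 : forall f, (phi f).1 = f.
  apply: divpow_generated.
  - by move=> v r; rewrite phiE.
  - by rewrite rmorph1.
  - by move=> c g h eg eh; rewrite linearP /= eg eh.
  - by move=> g h eg eh; rewrite rmorphM /= eg eh.
split.
- by move=> c u v; rewrite linearP.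
- by move=> f g; rewrite rmorphM /= !phi1 addrC.
- by move=> v r; rewrite phiE.
Qed.

End DividedPowerAlgebra.

Lemma lrmorphism_exists (K : fieldType) (A B : comAlgType K) (f : A -> B) :
  linear f -> (forall u v, f (u * v) = f u * f v) -> f 1 = 1 ->
  exists g : {lrmorphism A -> B}, forall u, g u = f u.
Proof.
move=> fL fM f1.
have fmm : monoid_morphism f by split.
pose g : {lrmorphism A -> B} := HB.pack f
  (GRing.isLinear.Build K A B *:%R f fL) (GRing.isMonoidMorphism.Build A B f fmm).
by exists g.
Qed.

(** Expand by Vandermonde with p ^ m split off from a + b. The term of index 0 vanishes because a +
    b - p ^ m < a, and in the others p divides the binomial of p ^ m. *)
Lemma dvdn_prime_bin p m a b : prime p ->
  (a < p ^ m)%N -> (b < p ^ m)%N -> (p ^ m <= a + b)%N -> (p %| 'C(a + b, a))%N.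
Proof.
move=> pp am bm ab; have -> : (a + b = p ^ m + (a + b - p ^ m))%N by rewrite subnKC.
rewrite -binomial.Vandermonde; apply: dvdn_sum => i _.
case: i => [[|i] ia] /=.
  by rewrite subn0 [X in (_ * X)%N]bin_small ?muln0 // ltn_subLR // addnC ltn_add2r.
apply: dvdn_mulr; apply: contraT => pC.
have : (p ^ m %| i.+1)%N.
  rewrite -(@Gauss_dvdl _ _ 'C(p ^ m, i.+1)); last by rewrite coprimeXl // prime_coprime.
  by rewrite -mul_bin_diag dvdn_mulr.
by move/(dvdn_leq (ltn0Sn i)); rewrite leqNgt (leq_ltn_trans _ am).
Qed.

(** The iterates of [u] under [f] satisfy a nontrivial linear relation. Injectivity cancels powers
    of [f] until the constant coefficient is nonzero, and then [u] is visibly in the image. *)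
Lemma inj_endo_surj (K : fieldType) (V : lmodType K) (T : finType) (e : T -> V)
    (f : V -> V) : (forall u, exists c : T -> K, u = \sum_t c t *: e t) ->
  linear f -> injective f -> forall u, exists v, f v = u.
Proof.
move=> espan fL finj u.
have fD v w : f (v + w) = f v + f w by have := fL 1 v w; rewrite !scale1r.
have f0 : f 0 = 0 by apply: (addrI (f 0)); rewrite -fD !addr0.
have fZ c v : f (c *: v) = c *: f v by have := fL c v 0; rewrite f0 !addr0.
(* [ev s] is the polynomial in [f] with coefficients [s], applied to [u]. *)
pose ev := foldr (fun c v => c *: u + f v) 0.
have evE s : ev s = \sum_(k < size s) s`_k *: iter k f u.
  elim: s => [|c s IH] /=; first by rewrite big_ord0.
  rewrite big_ord_recl /= IH; congr (_ + _); rewrite (big_morph f fD f0).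
  by apply: eq_bigr => k _; rewrite fZ.
have [s evs0 [c cs c0]] : exists2 s, ev s = 0 & exists2 c, c \in s & c != 0.
  pose N := #|T|.
  have [C CE] : {C : 'I_N.+1 -> T -> K | forall k : 'I_N.+1, iter k f u = \sum_t C k t *: e t}.
    have h (k : 'I_N.+1) := cid (espan (iter k f u)).
    by exists (fun k => projT1 (h k)) => k; apply: (projT2 (h k)).
  pose B : 'M[K]_(N.+1, N) := \matrix_(k, t) C k (enum_val t).
  have kB : kermx B != 0.
    rewrite kermx_eq0 /row_free neq_ltn; apply/orP; left.
    by rewrite ltnS rank_leq_col.
  have [r /sub_kermxP rB r0] := rowV0Pn kB.
  exists [seq r 0 k | k <- enum 'I_N.+1].
    rewrite evE size_map size_enum_ord.
    rewrite (eq_bigr (fun k : 'I_N.+1 => r 0 k *: iter k f u)); last first.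
      by move=> k _; rewrite (nth_map ord0) ?size_enum_ord // nth_ord_enum.
    rewrite (eq_bigr (fun k => \sum_t (r 0 k * C k t) *: e t)); last first.
      by move=> k _; rewrite CE scaler_sumr; apply: eq_bigr => t _; rewrite scalerA.
    rewrite exchange_big big1 //= => t _; rewrite -scaler_suml.
    have /rowP/(_ (enum_rank t)) := rB; rewrite !mxE => h.
    rewrite (_ : \sum_i _ = 0) ?scale0r // -[RHS]h; apply: eq_bigr => k _.
    by rewrite mxE enum_rankK.
  have [k rk] : exists k, r 0 k != 0.
    by apply/existsP; apply: contraNT r0 => /existsPn h; apply/eqP/rowP => k;
      rewrite mxE; apply/eqP/negPn/h.
  by exists (r 0 k) => //; apply: map_f; rewrite mem_enum.
elim: s evs0 cs => [//|d s IH] /= evs0; rewrite inE.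
have [d0|d0] := eqVneq d 0.
  rewrite d0 (negPf c0) /=; apply: IH; apply: finj.
  by rewrite f0 -[RHS]evs0 d0 scale0r add0r.
move=> _; exists (- d^-1 *: ev s); rewrite fZ.
move/eqP: evs0; rewrite addrC addr_eq0 => /eqP ->.
by rewrite scaleNr scalerN opprK scalerA mulVf // scale1r.
Qed.

Section InSpan.
Variables (K : fieldType) (V : lmodType K) (S : V -> Prop).

Lemma in_span_ind (P : V -> Prop) :
  P 0 -> (forall c u v, S u -> P v -> P (c *: u + v)) ->
  forall v, in_span S v -> P v.
Proof.
move=> P0 PS _ [s [sS ->]]; elim: s sS => [_|q s IH sS]; first by rewrite big_nil.
rewrite big_cons; apply: PS; first by apply: sS; rewrite inE eqxx.
by apply: IH => cu cus; apply: sS; rewrite inE cus orbT.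
Qed.

Lemma in_span0 : in_span S 0.
Proof. by exists [::]; split=> //; rewrite big_nil. Qed.

Lemma in_spanP c u v : S u -> in_span S v -> in_span S (c *: u + v).
Proof.
move=> Su [s [sS ->]]; exists ((c, u) :: s); split; last by rewrite big_cons.
by move=> cu; rewrite inE => /orP[/eqP ->//|]; apply: sS.
Qed.

Lemma in_span1 u : S u -> in_span S u.
Proof. by move=> Su; rewrite -[u]addr0 -[u]scale1r; apply: in_spanP in_span0. Qed.

Lemma in_spanD u v : in_span S u -> in_span S v -> in_span S (u + v).
Proof.
move=> Su Sv; elim/in_span_ind: u / Su => [|c u w Su Sw]; first by rewrite add0r.
by rewrite -addrA; apply: in_spanP.
Qed.

Lemma in_spanZ c u : in_span S u -> in_span S (c *: u).
Proof.
elim/in_span_ind: u / => [|d u w Su Sw]; first by rewrite scaler0; apply: in_span0.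
by rewrite scalerDr scalerA; apply: in_spanP.
Qed.

Lemma in_span_sum I (r : seq I) (P : pred I) (G : I -> V) :
  (forall i, P i -> in_span S (G i)) -> in_span S (\sum_(i <- r | P i) G i).
Proof. by move=> SG; elim/big_ind: _ => //; [apply: in_span0|apply: in_spanD]. Qed.

End InSpan.

(* The number of partitions of a set of [s * r] elements into [r] blocks of size
   [s]: the coefficient of [v ^ (s * r)] in [(v ^ (s)) ^ (r)]. *)
Definition block_partitions s r := ((s * r)`! %/ (s`! ^ r * r`!))%N.

(** The recurrence chooses the s - 1 companions of a distinguished element; it also shows that the
    division in the definition is exact. *)
Lemma block_partitionsE s r : (0 < s)%N ->
  (block_partitions s r * (s`! ^ r * r`!) = (s * r)`!)%N /\
  (block_partitions s r.+1 = block_partitions s r * 'C(s * r + s.-1, s * r))%N.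
Proof.
move=> s0; pose M := fix M r := if r is r'.+1
  then (M r' * 'C(s * r' + s.-1, s * r'))%N else 1%N.
have ME k : (M k * (s`! ^ k * k`!) = (s * k)`!)%N.
  elim: k => [|k IH] /=; first by rewrite muln0 expn0.
  have h : ('C(s * k + s.-1, s * k) * ((s * k)`! * (s.-1)`!) = (s * k + s.-1)`!)%N.
    by rewrite -(@bin_fact (s * k + s.-1) (s * k)) ?leq_addr // addKn.
  have fE : ((s * k.+1)`! = s * k.+1 * (s * k + s.-1)`!)%N.
    by rewrite {1}(_ : s * k.+1 = (s * k + s.-1).+1)%N ?factS; rewrite mulnSr -addnS prednK.
  have sE : (s`! = s * (s.-1)`!)%N by rewrite -{1}(prednK s0) factS prednK.
  rewrite fE -h -IH expnS factS; set t := (s`! ^ k)%N; rewrite sE; ring.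
have NE k : block_partitions s k = M k.
  by rewrite /block_partitions -ME mulnK // muln_gt0 expn_gt0 !fact_gt0.
by rewrite !NE.
Qed.

(** * Divided powers and derivations in coordinates *)

Section DividedPowerSystem.
Variables (K : fieldType) (p : nat) (E : vectType K) (n : nat) (x : n.-tuple E).
Hypothesis hpK : p \in [pchar K].
Hypothesis hx : basis_of fullv x.
Variables (A : comAlgType K) (dp : E -> nat -> A) (gam : A -> nat -> A).
Hypothesis hA : is_divpow_algebra dp.
Hypothesis hgam : is_divpow_system (mE dp x) gam.
Hypothesis hgamdp : extends_dp dp gam.
Variable eps : {rmorphism A -> K}.
Hypothesis epsZ : forall c u, eps (c *: u) = c * eps u.
Hypothesis eps_dp : forall v r, eps (dp v r) = (r == 0)%:R.
Variable dA : 'I_n -> A -> A.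
Hypothesis dAL : forall i, linear (dA i).
Hypothesis dAM : forall i f g, dA i (f * g) = dA i f * g + f * dA i g.
Hypothesis dA_dp : forall i v r,
  dA i (dp v r) = if r is r'.+1 then coord x i v *: dp v r' else 0.

Let M := mE dp x.
Local Notation mono := (monomial dp x).

Lemma coord_tnth i j : coord x i (tnth x j) = (i == j)%:R.
Proof.
rewrite (tnth_nth 0) coord_free // ?[j == i]eq_sym //; exact: basis_free hx.
Qed.

Lemma vect_coord v : v = \sum_i coord x i v *: tnth x i.
Proof.
rewrite {1}(coord_basis hx (memvf v)).
by apply: eq_bigr => i _; rewrite (tnth_nth 0).
Qed.

Lemma divpow0 r : dp 0 r = (r == 0%N)%:R.
Proof.
have [[r0 _ rZ _] _ _] := hA.
by rewrite -[0](scale0r 0) rZ; case: r => [|r]; rewrite ?r0 ?scale1r // expr0n scale0r.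
Qed.

Lemma monomialM al be :
  exists c : K, mono al * mono be = c *: mono (fun i => (al i + be i)%N).
Proof.
have [[r0 rD rZ rM] _ _] := hA.
exists (\prod_i 'C(al i + be i, al i)%:R).
rewrite /monomial -big_split /= (eq_bigr _ (fun i _ => rM _ _ _)) big_split /=.
rewrite -mulr_algl; congr (_ * _); rewrite -[LHS]scale1r.
elim/big_rec2: _ => [|i u v _]; first by rewrite scale1r.
by rewrite !scale1r => ->; rewrite -scaler_nat -scalerAl mul1r scalerA.
Qed.

Lemma monomial1 i r : mono (fun j => if j == i then r else 0%N) = dp (tnth x i) r.
Proof.
have [[r0 rD rZ rM] _ _] := hA.
rewrite /monomial (bigD1 i) //= eqxx big1 ?mulr1 // => j /negPf ->.
exact: r0.
Qed.

Lemma monomial0 al : (forall i, al i = 0%N) -> mono al = 1.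
Proof.
have [[r0 rD rZ rM] _ _] := hA.
by move=> al0; rewrite /monomial big1 // => i _; rewrite al0 r0.
Qed.

(** Restricted to exponents below [N] and to coordinates that occur in [v], so that it serves for
    [O(F)] as well as for [A]. *)
Lemma divpow_expand (B : A -> Prop) N v :
  B 0 -> B 1 -> (forall c g h, B g -> B h -> B (c *: g + h)) ->
  (forall g h, B g -> B h -> B (g * h)) ->
  (forall i r, coord x i v != 0 -> (r < N)%N -> B (dp (tnth x i) r)) ->
  forall r, (r < N)%N -> B (dp v r).
Proof.
have [[r0 rD rZ rM] _ _] := hA.
move=> B0 B1 BL BM Bx; rewrite [v]vect_coord.
have BZ c g : B g -> B (c *: g) by move=> Bg; rewrite -[_ *: _]addr0; apply: BL.
elim/big_ind: _ => [r _|u w Bu Bw r rN|i _ r rN].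
- by rewrite divpow0; case: (r == 0%N).
- rewrite rD; elim/big_ind: _ => [//|f g Bf Bg|i _].
    by rewrite -[f]scale1r; apply: BL.
  apply: BM; [apply: Bu|apply: Bw]; apply: leq_ltn_trans rN.
    by rewrite -ltnS.
  exact: leq_subr.
- rewrite rZ; case: r rN => [|r] rN; first by rewrite r0 scale1r.
  have [->|c0] := eqVneq (coord x i v) 0; first by rewrite expr0n scale0r.
  by apply: BZ; apply: Bx.
Qed.

Lemma span_monomials f : in_span (fun u => exists al, u = mono al) f.
Proof.
have mono1 : in_span (fun u => exists al, u = mono al) 1.
  by apply: in_span1; exists (fun=> 0%N); rewrite monomial0.
have spM g h : in_span (fun u => exists al, u = mono al) g ->
  in_span (fun u => exists al, u = mono al) h ->
  in_span (fun u => exists al, u = mono al) (g * h).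
  move=> sg sh; elim/in_span_ind: g / sg => [|c _ w [al ->] IH].
    by rewrite mul0r; apply: in_span0.
  rewrite mulrDl; apply: in_spanD => //; rewrite -scalerAl; apply: in_spanZ.
  elim/in_span_ind: h / sh {IH} => [|d _ t [be ->] IH].
    by rewrite mulr0; apply: in_span0.
  rewrite mulrDr; apply: in_spanD => //; rewrite -scalerAr; apply: in_spanZ.
  have [e ->] := monomialM al be; apply: in_spanZ; apply: in_span1.
  by eexists.
have spL c g h : in_span (fun u => exists al, u = mono al) g ->
  in_span (fun u => exists al, u = mono al) h ->
  in_span (fun u => exists al, u = mono al) (c *: g + h).
  by move=> *; apply: in_spanD => //; apply: in_spanZ.
move: f; apply: (divpow_generated hA) => // v r.
apply: (@divpow_expand _ r.+1) => //; first exact: in_span0.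
by move=> i t _ _; apply: in_span1; eexists; rewrite -monomial1.
Qed.

Lemma eps_monomial al : eps (mono al) = [forall i, al i == 0%N]%:R.
Proof.
rewrite rmorph_prod; case: forallP => [al0|nal0].
  by rewrite big1 // => i _; rewrite eps_dp al0.
have [i ali] : exists i, al i != 0%N.
  by apply: contrapT => h; apply: nal0 => i; apply: contraT => h'; case: h; exists i.
by rewrite (bigD1 i) //= eps_dp (negPf ali) mul0r.
Qed.

Lemma mE_eps f : M f <-> eps f = 0.
Proof.
split=> [|f0].
  elim/in_span_ind: f / => [|c _ v [al [i ali] ->] v0]; first by rewrite rmorph0.
  rewrite rmorphD epsZ v0 addr0 eps_monomial.
  by case: forallP => [/(_ i)|_]; rewrite ?(negPf ali) // mulr0.
suff : M (f - (eps f)%:A) by rewrite f0 scale0r subr0.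
elim/in_span_ind: f / (span_monomials f) {f0} => [|c _ v [al ->] IH].
  by rewrite rmorph0 scale0r subr0; apply: in_span0.
rewrite rmorphD epsZ scalerDl -scalerA opprD addrACA -scalerBr.
apply: in_spanD => //; apply: in_spanZ; rewrite eps_monomial.
case: forallP => [al0|nal0].
  by rewrite monomial0 ?scale1r ?subrr; [apply: in_span0|move=> i; apply/eqP].
rewrite scale0r subr0; apply: in_span1; exists al => //.
by apply: contrapT => h; apply: nal0 => i; apply: contraT => h'; case: h; exists i.
Qed.

Lemma mE_dp v r : (0 < r)%N -> M (dp v r).
Proof. by case: r => // r _; apply/mE_eps; rewrite eps_dp. Qed.

Lemma mE_mul a f : M f -> M (a * f).
Proof. by move=> /mE_eps f0; apply/mE_eps; rewrite rmorphM f0 mulr0. Qed.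

Lemma mE_sum I (r : seq I) (P : pred I) (G : I -> A) :
  (forall i, P i -> M (G i)) -> M (\sum_(i <- r | P i) G i).
Proof. exact: in_span_sum. Qed.

(** Identities between divided powers pass to sums by the addition axiom, so they need checking only
    on multiples of the divided powers of basis vectors. *)
Lemma mE_ind (P : A -> Prop) : P 0 ->
  (forall f g, M f -> M g -> P f -> P g -> P (f + g)) ->
  (forall a i s, (0 < s)%N -> P (a * dp (tnth x i) s)) -> forall f, M f -> P f.
Proof.
move=> P0 PD Pdp f [s [sS ->]].
have Pq q : q \in s -> M (q.1 *: q.2) /\ P (q.1 *: q.2).
  move=> /sS[al [i ali] ->].
  rewrite /monomial (bigD1 i) //= scalerAr mulrC -lt0n in ali *; split; last exact: Pdp.
  by apply: mE_mul; apply: mE_dp.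
elim: s Pq {sS} => [|q s IH] Pq; first by rewrite big_nil.
rewrite big_cons; have [Mq Pq'] := Pq q (mem_head _ _).
have {}IH : M (\sum_(j <- s) j.1 *: j.2) /\ P (\sum_(j <- s) j.1 *: j.2).
  split; last by apply: IH => t ts; apply: Pq; rewrite inE ts orbT.
  rewrite big_seq; apply: mE_sum => t ts.
  by have [] := Pq t; rewrite // inE ts orbT.
by apply: PD => //; case: IH.
Qed.

Lemma mE0 : M 0. Proof. exact: in_span0. Qed.

Lemma gam0 r : gam 0 r = (r == 0%N)%:R.
Proof.
have [g0 _ _ gM _] := hgam; case: r => [|r]; first by case: (g0 0 mE0).
by rewrite -{1}[0](mul0r 0) gM ?expr0n ?mul0r //; apply: mE0.
Qed.

Lemma gam_dp v s r : (0 < s)%N ->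
  gam (dp v s) r = (block_partitions s r)%:R * dp v (s * r)%N.
Proof.
have [_ _ _ _ [_ gg]] := hgam.
by move=> s0; rewrite -(hgamdp v s) gg ?hgamdp //; apply: mE_dp.
Qed.

Lemma gam_scale c f r : M f -> gam (c *: f) r = c ^+ r *: gam f r.
Proof.
have [_ _ _ gM _] := hgam.
by move=> Mf; rewrite -mulr_algl gM // exprZn expr1n mulr_algl.
Qed.

(** The axioms of divided powers do not mention derivations. On a divided power of a basis vector
    the rule is the recurrence for [block_partitions]; it extends to multiples and sums. *)
Lemma deriv_gam i f r : M f -> dA i (gam f r.+1) = gam f r * dA i f.
Proof.
have [g0 gE gD gM [gg _]] := hgam; have [[r0 _ _ rM] _ _] := hA.
move=> Mf; elim/mE_ind: f / Mf r => [r|f g Mf Mg IHf IHg r|a j s s0 r].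
- by rewrite gam0 !(drv0 (dAL i)) mulr0.
- rewrite !gD // (drv_sum (dAL i)) (drvD (dAL i)) (eq_bigr _ (fun j _ => dAM _ _ _)).
  rewrite big_split /= mulrDr; congr (_ + _).
    rewrite big_ord_recl /= (g0 f Mf).1 (drv1 (dAM i)) mul0r add0r mulr_suml.
    by apply: eq_bigr => j _; rewrite /bump /= add1n IHf subSS mulrAC.
  rewrite big_ord_recr /= subnn (g0 g Mg).1 (drv1 (dAM i)) mulr0 addr0 mulr_suml.
  by apply: eq_bigr => j _; rewrite subSn -1?ltnS // IHg mulrA.
- case: s s0 => // s s0; set h := dp _ s.+1; have Mh : M h by apply: mE_dp.
  have dh : dA i (gam h r.+1) = gam h r * dA i h.
    have e : (s.+1 * r.+1 = (s.+1 * r + s).+1)%N by rewrite mulnSr addnS.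
    rewrite !gam_dp // (drv_natl (dAL i) (dAM i)) (block_partitionsE r s0).2 e !dA_dp.
    by rewrite -!scalerAr -mulrA rM natrM mulrA.
  rewrite !gM // [LHS]dAM (drvX (dAM i)) dh dAM.
  have := gg h 1%N r Mh; rewrite (g0 h Mh).2 add1n bin1 => hh.
  rewrite exprS; transitivity (a ^+ r * dA i a * (r.+1%:R * gam h r.+1)
    + a * a ^+ r * (gam h r * dA i h)); first by ring.
  by rewrite -hh; ring.
Qed.

Lemma dA_monomial i al :
  dA i (mono al) = if al i is k.+1
    then mono (fun j => if j == i then k else al j) else 0.
Proof.
rewrite /monomial (bigD1 i) //= dAM.
have -> : dA i (\prod_(j < n | j != i) dp (tnth x j) (al j)) = 0.
  elim/big_ind: _ => [|f g df dg|j ji]; first exact: drv1 (dAM i).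
    by rewrite dAM df dg mul0r mulr0 addr0.
  by rewrite dA_dp; case: (al j) => // k; rewrite coord_tnth eq_sym (negPf ji) scale0r.
rewrite mulr0 addr0 dA_dp; case: (al i) => [|k]; first by rewrite mul0r.
rewrite coord_tnth eqxx scale1r [RHS](bigD1 i) //= eqxx; congr (_ * _).
by apply: eq_bigr => j /negPf ->.
Qed.

Definition dword (w : seq 'I_n) (f : A) : A := foldl (fun g i => dA i g) f w.

Lemma dword_linear w : linear (dword w).
Proof.
elim: w => [//|i w IH] c f g; rewrite /dword /= -!/(dword w _).
by rewrite dAL IH.
Qed.

Lemma eps_dword_monomial w al :
  eps (dword w (mono al)) = [forall i, al i == count_mem i w]%:R.
Proof.
elim: w al => [|i w IH] al; first exact: eps_monomial.
rewrite /dword /= -/(dword w _) dA_monomial; case e: (al i) => [|k].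
  rewrite (drv0 (dword_linear w)) rmorph0.
  by case: forallP => [/(_ i)|//]; rewrite e eqxx.
rewrite IH; congr (nat_of_bool _)%:R; apply: eq_forallb => j.
by have [->|ji] := eqVneq j i; rewrite ?e ?eqxx // eq_sym (negPf ji).
Qed.

Lemma dword_monomial0 w al : (\sum_i al i < size w)%N -> dword w (mono al) = 0.
Proof.
elim: w al => [//|i w IH] al /= alw.
rewrite /dword /= -/(dword w _) dA_monomial; case e: (al i) => [|k].
  exact: drv0 (dword_linear w).
apply: IH; move: alw; rewrite (bigD1 i) //= e addSn ltnS; apply: leq_ltn_trans.
rewrite (bigD1 i) //= eqxx leq_add2l; apply: leq_sum => j /negPf ->.
exact: leqnn.
Qed.

(** Taylor coefficients: the derivative along a word, evaluated at the point, picks out the one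
    monomial whose exponents are the multiplicities of the letters. *)
Lemma dword_eq0 f : (forall w, eps (dword w f) = 0) -> f = 0.
Proof.
have [s fE] : exists s : seq (K * {ffun 'I_n -> nat}), f = \sum_(q <- s) q.1 *: mono q.2.
  elim/in_span_ind: f / (span_monomials f) => [|c _ v [al ->] [s ->]].
    by exists [::]; rewrite big_nil.
  exists ((c, [ffun i => al i]) :: s); rewrite big_cons /=.
  by congr (_ *: _ + _); apply: eq_bigr => i _; rewrite ffunE.
pose U := undup [seq q.2 | q <- s].
pose C t := \sum_(q <- s | q.2 == t) q.1.
have {}fE : f = \sum_(t <- U) C t *: mono t.
  rewrite fE (eq_bigr (fun t => \sum_(q <- s | q.2 == t) q.1 *: mono q.2)); last first.
    by move=> t _; rewrite scaler_suml; apply: eq_bigr => q /eqP ->.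
  rewrite (exchange_big_dep xpredT) //= [LHS]big_seq [RHS]big_seq.
  apply: eq_bigr => q qs; rewrite (eq_bigl (pred1 q.2)); last by move=> t; rewrite eq_sym.
  rewrite -big_filter filter_pred1_uniq ?big_seq1 ?undup_uniq //.
  by rewrite mem_undup; apply: map_f.
move=> f0; rewrite fE big_seq big1 // => t tU; rewrite (_ : C t = 0) ?scale0r //.
pose w := flatten [seq nseq (t i) i | i <- enum 'I_n].
have cw i : count_mem i w = t i.
  rewrite /w count_flatten -map_comp (eq_map (g := fun j => ((j == i) * t j)%N)); last first.
    by move=> j /=; rewrite count_nseq.
  rewrite sumnE big_map big_enum /= (bigD1 i) //= eqxx mul1n big1 ?addn0 //.
  by move=> j /negPf ->.
have := f0 w; rewrite fE (drv_sum (dword_linear w)) rmorph_sum (bigD1_seq t) ?undup_uniq //=.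
rewrite (drvZ (dword_linear w)) epsZ eps_dword_monomial.
rewrite (introT forallP) ?mulr1 => [|i]; last by rewrite cw.
rewrite big1 ?addr0 // => u ut; rewrite (drvZ (dword_linear w)) epsZ eps_dword_monomial.
case: forallP => [uw|]; last by rewrite mulr0.
by case/eqP: ut; apply/ffunP => i; rewrite -cw; apply/eqP/uw.
Qed.

Lemma dA_comm i j f : dA i (dA j f) = dA j (dA i f).
Proof.
move: f; apply: (divpow_generated hA).
- move=> v [|[|r]]; rewrite !dA_dp ?(drv0 (dAL _)) //.
    by rewrite !(drvZ (dAL _)) !dA_dp !scaler0.
  by rewrite !(drvZ (dAL _)) !dA_dp !scalerA mulrC.
- by rewrite !(drv1 (dAM _)) !(drv0 (dAL _)).
- by move=> c g h eg eh; rewrite !dAL eg eh.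
- by move=> g h eg eh; rewrite !dAM !(drvD (dAL _)) !dAM eg eh; ring.
Qed.

(* Pairing [gam y r] with a d-fold derivative detects the linear part of [y]. *)
Lemma eps_iter_gam j y d r h : M y -> (d <= r)%N ->
  eps (iter d (dA j) (gam y r * h)) = (r == d)%:R * eps (dA j y) ^+ d * eps h.
Proof.
have [g0 gE _ _ _] := hgam.
move=> My; elim: d r h => [|d IH] [|r] h //= dr.
- by rewrite (g0 y My).1 mul1r expr0 !mul1r.
- have /mE_eps gy0 := gE y r.+1 My (ltn0Sn r).
  by rewrite rmorphM gy0 !mul0r.
- have iterD t u v : iter t (dA j) (u + v) = iter t (dA j) u + iter t (dA j) v.
    by elim: t => //= t ->; rewrite (drvD (dAL j)).
  rewrite -iterS iterSr dAM deriv_gam // -mulrA iterD rmorphD IH // IH ?leqW //.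
  rewrite (gtn_eqF dr) eqSS rmorphM !mul0r addr0.
  by rewrite exprSr !mulrA.
Qed.

(** * The algebra of a flag and its coordinate changes *)

Variables (F : nat -> {vspace E}) (m : 'I_n -> nat).
Hypothesis hF : is_flag F.
Hypothesis hFx : forall k, F k = <<[seq v <- x | v \in F k]>>%VS.
Hypothesis hm : forall i, is_height F (tnth x i) (m i).
Local Notation OF := (flag_algebra p F dp).
Variable D : 'I_n -> OF -> OF.
Hypothesis hD : is_partials x D.

Let p_prime : prime p := pcharf_prime hpK.

Lemma flag_mono k l : (k <= l)%N -> (F l <= F k)%VS.
Proof.
have [_ Fk _] := hF; elim: l => [|l IH]; first by rewrite leqn0 => /eqP ->.
rewrite leq_eqVlt => /orP[/eqP -> //|]; rewrite ltnS => /IH; exact: subv_trans.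
Qed.

Lemma mem_flag_basis j k : (tnth x j \in F k) = (k < m j)%N.
Proof.
have [xm mmin] := hm j; apply/idP/idP => [xk|]; last first.
  by apply: contraTT => /mmin; rewrite -leqNgt.
rewrite ltnNge; apply: contra xm => mk; exact: subvP (flag_mono mk) _ xk.
Qed.

Lemma height_gt0 j : (0 < m j)%N.
Proof. by have [F0 _ _] := hF; rewrite -mem_flag_basis F0 memvf. Qed.

Lemma mem_flag_coord v k :
  v \in F k <-> forall j, coord x j v != 0 -> (k < m j)%N.
Proof.
split=> [vk j cj|h].
  rewrite -mem_flag_basis; apply: contraNT cj => xjk; apply/eqP.
  move: vk; rewrite hFx => vk.
  have -> := @coord_span _ _ _ (in_tuple [seq v <- x | v \in F k]) v vk.
  rewrite linear_sum big1 //= => i _; rewrite linearZ /=.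
  set u := _`_i; have : u \in [seq v <- x | v \in F k] by apply: mem_nth; case: i @u.
  rewrite mem_filter => /andP[uk /tnthP[l ul]].
  rewrite ul coord_tnth; case: eqP => [jl|]; last by rewrite mulr0.
  by rewrite jl -ul uk in xjk.
rewrite [v]vect_coord; apply: memv_suml => j _.
have [->|/h] := eqVneq (coord x j v) 0; first by rewrite scale0r mem0v.
by rewrite -mem_flag_basis => ?; apply: memvZ.
Qed.

Definition divpowO j r : OF := insubd 0 (dp (tnth x j) r).

Lemma divpowOE j r : (r < p ^ m j)%N -> \val (divpowO j r) = dp (tnth x j) r.
Proof.
move=> rm; rewrite /divpowO val_insubd ifT //; apply/flag_predP => B SB _ _ _; apply: SB.
exists (m j).-1, (tnth x j), r.
by rewrite mem_flag_basis prednK ?height_gt0.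
Qed.

(** Compatibility of the basis ensures that a vector of [F i] involves only basis vectors of height
    above i, whose divided powers below p ^ (i + 1) are available. *)
Lemma flag_algebra_ind (P : OF -> Prop) : P 1 ->
  (forall c u v, P u -> P v -> P (c *: u + v)) ->
  (forall u v, P u -> P v -> P (u * v)) ->
  (forall j r, (r < p ^ m j)%N -> P (divpowO j r)) -> forall u, P u.
Proof.
move=> P1 PL PM Px u; pose B f := exists2 v : OF, \val v = f & P v.
have P0 : P 0 by have := PL (-1) 1 1 P1 P1; rewrite scaleN1r addNr.
have B1 : B 1 by exists 1; rewrite ?rmorph1.
have BL c g h : B g -> B h -> B (c *: g + h).
  by move=> [v <- Pv] [w <- Pw]; exists (c *: v + w); rewrite ?linearP //; apply: PL.
have BM g h : B g -> B h -> B (g * h).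
  by move=> [v <- Pv] [w <- Pw]; exists (v * w); rewrite ?rmorphM //; apply: PM.
have /flag_predP/(_ B)[] := valP u => //; last by move=> v /val_inj ->.
move=> _ [i [v [r [vi ri ->]]]]; apply: (@divpow_expand B (p ^ i.+1)) ri => //.
  by exists 0; rewrite ?rmorph0.
move=> j t /((mem_flag_coord v i).1 vi) ij tp.
have tm : (t < p ^ m j)%N by rewrite (leq_trans tp) // leq_exp2l ?prime_gt1.
by exists (divpowO j t); [apply: divpowOE|apply: Px].
Qed.

Definition monoO (al : 'I_n -> nat) : OF := \prod_j divpowO j (al j).

Lemma monoOE al : (forall j, al j < p ^ m j)%N -> \val (monoO al) = mono al.
Proof. by move=> alb; rewrite rmorph_prod; apply: eq_bigr => j _; apply: divpowOE. Qed.

Definition bounded_monoO (u : OF) : Prop :=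
  exists2 al, (forall j, al j < p ^ m j)%N & u = monoO al.

(** Bounded monomials span a subalgebra: when an exponent of a product leaves its range, the
    binomial coefficient is divisible by p and the product is zero. *)
Lemma span_flag_algebra u : in_span bounded_monoO u.
Proof.
elim/flag_algebra_ind: u => [|c u v su sv|u v su sv|j r rj].
- apply: in_span1; exists (fun=> 0%N); first by move=> j; rewrite expn_gt0 prime_gt0.
  apply: val_inj; rewrite monoOE ?monomial0 ?rmorph1 //.
  by move=> j; rewrite expn_gt0 prime_gt0.
- by apply: in_spanD => //; apply: in_spanZ.
- elim/in_span_ind: u / su => [|c _ w [al alb ->] IH]; first by rewrite mul0r; apply: in_span0.
  rewrite mulrDl; apply: in_spanD => //; rewrite -scalerAl; apply: in_spanZ.
  elim/in_span_ind: v / sv {IH} => [|d _ t [be beb ->] IH]; first by rewrite mulr0; apply: in_span0.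
  rewrite mulrDr; apply: in_spanD => //; rewrite -scalerAr; apply: in_spanZ.
  have [alp|[j abj]] : (forall j, al j + be j < p ^ m j)%N \/ exists j, (p ^ m j <= al j + be j)%N.
    have [/forallP|/forallPn[j]] := boolP [forall j, al j + be j < p ^ m j]%N; first by left.
    by rewrite -leqNgt; right; exists j.
    have [e eE] := monomialM al be.
    rewrite (_ : _ * _ = e *: monoO (fun j => al j + be j)%N).
      by apply: in_spanZ; apply: in_span1; eexists; last by [].
    by apply: val_inj; rewrite rmorphM linearZ /= !monoOE.
  rewrite (_ : _ * _ = 0); first exact: in_span0.
  have [[_ _ _ rM] _ _] := hA.
  apply: val_inj; rewrite rmorphM rmorph0 /= !monoOE // -big_split /= (bigD1 j) //= rM.
  have := dvdn_prime_bin p_prime (alb j) (beb j) abj.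
  rewrite (dvdn_pcharf hpK) => /eqP C0.
  by rewrite mulr_natl -scaler_nat C0 scale0r mul0r.
- apply: in_span1; exists (fun i => if i == j then r else 0%N).
    by move=> i; case: eqP => [->|_]; rewrite ?expn_gt0 ?prime_gt0.
  apply: val_inj; rewrite monoOE ?monomial1 ?divpowOE //.
  by move=> i; case: eqP => [->|_]; rewrite ?expn_gt0 ?prime_gt0.
Qed.

Lemma DL i : linear (D i). Proof. by case: (hD i) => -[]. Qed.
Lemma DM i u v : D i (u * v) = D i u * v + u * D i v.
Proof. by case: (hD i) => -[]. Qed.

Lemma val_D i u : \val (D i u) = dA i (\val u).
Proof.
elim/flag_algebra_ind: u => [|c u v eu ev|u v eu ev|j r rj].
- by rewrite (drv1 (DM i)) rmorph1 (drv1 (dAM i)) rmorph0.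
- by rewrite DL !linearP /= eu ev dAL.
- by rewrite DM rmorphD !rmorphM /= eu ev dAM.
- have [_ /(_ j r (divpowO j r) (divpowOE rj)) ->] := hD i.
  rewrite divpowOE // dA_dp; case: r {rj} => [|r]; rewrite ?andbF // andbT coord_tnth.
  by case: eqP; rewrite ?scale1r ?scale0r.
Qed.

Lemma D_comm i j u : D i (D j u) = D j (D i u).
Proof. by apply: val_inj; rewrite !val_D dA_comm. Qed.

Definition epsO : {rmorphism OF -> K} := eps \o @flag_incl _ _ _ _ _ dp.

Lemma epsOE u : epsO u = eps (\val u). Proof. by []. Qed.

Lemma epsOZ c u : epsO (c *: u) = c * epsO u.
Proof. by rewrite !epsOE linearZ epsZ. Qed.

(** All Taylor coefficients vanish: short words leave an element of positive order, and words longer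
    than the sum of the p ^ m_j kill every bounded monomial. *)
Lemma mpow_nilpotent : exists N, forall u, mpow epsO N u -> u = 0.
Proof.
exists (\sum_j p ^ m j).+1 => u mu; apply: val_inj; rewrite rmorph0; apply: dword_eq0 => w.
have [|wN] := leqP (size w) (\sum_j p ^ m j); last first.
  rewrite (_ : dword w _ = 0) ?rmorph0 //.
  elim/in_span_ind: u / (span_flag_algebra u) {mu} => [|c _ v [al alb ->] IH].
    by rewrite rmorph0 (drv0 (dword_linear w)).
  rewrite linearP /= dword_linear IH addr0 monoOE // dword_monomial0 ?scaler0 //.
  by apply: leq_ltn_trans wN; apply: leq_sum => j _; apply: ltnW.
rewrite -ltnS; move: (_.+1) mu => N; elim: w u N => [|i w IH] u [|N] mu //.
  move=> _; rewrite /dword /=; apply/(mpow1P epsO u); exact: mpow_le mu.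
rewrite /dword /= -/(dword w _) -val_D ltnS; apply: IH.
exact: (mpow_deriv DL DM).
Qed.

Definition boundedO_index := {dffun forall j : 'I_n, 'I_(p ^ m j)}.

Lemma flag_algebra_finite u : exists c : boundedO_index -> K,
  u = \sum_t c t *: monoO (fun j => t j).
Proof.
elim/in_span_ind: u / (span_flag_algebra u) => [|c _ v [al alb ->] [d ->]].
  by exists (fun=> 0); rewrite big1 // => t _; rewrite scale0r.
pose t0 : boundedO_index := [ffun j => Ordinal (alb j)].
exists (fun t => c * (t == t0)%:R + d t).
rewrite [RHS](eq_bigr _ (fun t _ => scalerDl _ _ _)) big_split /=; congr (_ + _).
rewrite (bigD1 t0) //= eqxx mulr1 big1 ?addr0 => [|t /negPf ->]; last by rewrite mulr0 scale0r.
by congr (_ *: _); apply: eq_bigr => j _; rewrite ffunE.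
Qed.

Local Notation X j := (flag_elem p F dp (tnth x j)).

Lemma XE j : \val (X j) = dp (tnth x j) 1.
Proof. exact: (flag_elemE _ _ hF (prime_gt1 p_prime)). Qed.

Lemma D_X i j : D i (X j) = (i == j)%:R.
Proof.
have [[r0 _ _ _] _ _] := hA.
by apply: val_inj; rewrite val_D XE dA_dp r0 coord_tnth rmorph_nat -scaler_nat.
Qed.

Lemma epsO_X j : epsO (X j) = 0.
Proof. by rewrite epsOE XE eps_dp. Qed.

Local Notation inO f := (f \in flag_pred p F dp).

Lemma mF_mE (u : OF) : mF x m u -> M (\val u).
Proof.
case=> s [sS ->]; exists s; split=> // q qs.
by have [al [ali _ ->]] := sS q qs; exists al.
Qed.

Lemma mF_X j : mF x m (X j).
Proof.
apply: in_span1; exists (fun i => if i == j then 1%N else 0%N); split.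
- by exists j; rewrite eqxx.
- move=> i; case: eqP => _; rewrite ?expn_gt0 ?prime_gt0 //.
  by apply: leq_ltn_trans (height_gt0 i) _; apply: ltn_expl (prime_gt1 p_prime).
- by rewrite monomial1 XE.
Qed.

Lemma mE_val u : epsO u = 0 -> M (\val u).
Proof. by move=> u0; apply/mE_eps. Qed.

Lemma exp_gam f r : M f -> f ^+ r = r`!%:R * gam f r.
Proof.
have [g0 _ _ _ [gg _]] := hgam.
move=> Mf; elim: r => [|r IH]; first by rewrite (g0 f Mf).1 mul1r.
rewrite exprSr IH -{2}(g0 f Mf).2 -mulrA gg // addn1 binSn mulrA -natrM.
by rewrite factS mulnC.
Qed.

Lemma natr_pchar k : (p %| k)%N -> k%:R = 0 :> A.
Proof. by rewrite (dvdn_pcharf hpK) => /eqP k0; rewrite -scaler_nat k0 scale0r. Qed.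

Lemma exp_mE f r : M f -> (p <= r)%N -> f ^+ r = 0.
Proof.
move=> Mf pr; rewrite exp_gam // natr_pchar ?mul0r //.
by apply: dvdn_fact; rewrite prime_gt0.
Qed.

Lemma gam_smallO u r : epsO u = 0 -> (r < p)%N -> inO (gam (\val u) r).
Proof.
move=> u0 rp; have Mu := mE_val u0.
have r0 : (r`!)%:R != 0 :> K.
  rewrite -(dvdn_pcharf hpK); elim: r rp => [|r IH] rp.
    by rewrite dvdn1 neq_ltn prime_gt1 ?orbT.
  by rewrite factS Euclid_dvdM // negb_or IH ?(ltnW rp) // gtnNdvd.
have -> : gam (\val u) r = (r`!%:R)^-1 *: \val u ^+ r.
  by rewrite exp_gam // mulr_natl -scaler_nat scalerA mulVf // scale1r.
by rewrite -rmorphXn rpredZ // (valP (u ^+ r)).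
Qed.

(** On a product g h of elements of the ideal, (g h)^(r) = g^r h^(r) is zero for r >= p and lies in
    [O(F)] for r < p; sums follow from the addition axiom. *)
Lemma gam_squareO u r : mpow epsO 2 u -> inO (gam (\val u) r).
Proof.
have [g0 _ gD gM _] := hgam.
move ek: 2%N => k mu; elim: mu ek r => [//|j g h eg mh _ [ej] r|j _ r|j g h mg IHg mh IHh ek r].
- have eh : epsO h = 0 by apply/(mpow1P epsO); rewrite ej.
  rewrite rmorphM gM; last exact: mE_val.
  have [rp|pr] := ltnP r p; last by rewrite exp_mE ?mul0r ?rpred0 //; apply: mE_val.
  by rewrite -rmorphXn rpredM ?gam_smallO // (valP (g ^+ r)).
- by rewrite rmorph0 gam0; case: eqP => _; rewrite ?rpred0 ?rpred1.
- have eM f : mpow epsO j f -> M (\val f).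
    by move=> mf; apply: mE_val; apply/(mpow1P epsO); rewrite -ek in mf; apply: mpow_pred.
  rewrite rmorphD gD; [|exact: eM|exact: eM].
  by apply: rpred_sum => i _; rewrite rpredM ?IHg ?IHh.
Qed.

Lemma dp1_lin c u v : dp (c *: u + v) 1 = c *: dp u 1 + dp v 1.
Proof.
have [[r0 rD rZ _] _ _] := hA.
by rewrite rD big_ord_recl big_ord1 /= /bump /= !r0 mul1r mulr1 rZ expr1 addrC.
Qed.

Lemma dp1_sum (c : 'I_n -> K) :
  dp (\sum_j c j *: tnth x j) 1 = \sum_j c j *: dp (tnth x j) 1.
Proof.
elim: (index_enum _) => [|j s IH]; first by rewrite !big_nil divpow0.
by rewrite !big_cons dp1_lin IH.
Qed.

Lemma dp_flagO v i r : v \in F i -> (r < p ^ i.+1)%N -> inO (dp v r).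
Proof. by move=> vi ri; apply/flag_predP => B SB _ _ _; apply: SB; exists i, v, r. Qed.

(** The linear part lies in the last term of the flag that contains the i-th basis vector, and the
    remainder has all its divided powers in [O(F)]. *)
Lemma gam_admissible (N : 'M[K]_n) i (y : OF) r :
    height_compatible m N -> mpow epsO 2 (y - \sum_j N i j *: X j) ->
  (r < p ^ m i)%N -> inO (gam (\val y) r).
Proof.
have [_ _ gD _ _] := hgam.
move=> hN my rm; set l := \sum_j _ in my.
have lE : \val l = dp (\sum_j N i j *: tnth x j) 1.
  by rewrite dp1_sum linear_sum; apply: eq_bigr => j _; rewrite linearZ /= XE.
have -> : \val y = \val l + \val (y - l) by rewrite -rmorphD addrC subrK.
rewrite gD; last 2 first.
- by rewrite lE; apply: mE_dp.
- by apply: mE_val; apply/(mpow1P epsO); apply: mpow_pred.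
apply: rpred_sum => k _; apply: rpredM; last exact: gam_squareO.
rewrite lE hgamdp.
apply: (@dp_flagO _ (m i).-1); last first.
  by rewrite prednK ?height_gt0 //; apply: leq_ltn_trans rm; rewrite -ltnS.
apply/mem_flag_coord => j; rewrite linear_sum (bigD1 j) //= big1 => [|l' lj].
  rewrite addr0 linearZ /= coord_tnth eqxx mulr1 => /hN.
  by case: (m i) (height_gt0 i).
by rewrite linearZ /= coord_tnth eq_sym (negPf lj) mulr0.
Qed.

(** * Substitutions that define elements of the group *)

Section CoordinateChange.
Variable y : 'I_n -> OF.
Hypothesis y0 : forall i, epsO (y i) = 0.
Hypothesis yadm : forall i r, (r < p ^ m i)%N -> inO (gam (\val (y i)) r).
Hypothesis yJ : \matrix_(i, j) epsO (D j (y i)) \in unitmx.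

Let Y v := \sum_i coord x i v *: \val (y i).

Let MY v : M (Y v).
Proof.
apply/mE_eps; rewrite rmorph_sum big1 // => i _.
by rewrite epsZ -epsOE y0 mulr0.
Qed.

Let substitution : exists phi : {lrmorphism A -> A}, forall v r, phi (dp v r) = gam (Y v) r.
Proof.
have [_ ex _] := hA; have [g0 _ gD _ [gg _]] := hgam; apply: ex; split.
- by move=> v; case: (g0 (Y v) (MY v)).
- move=> u v r; rewrite -(gD _ _ _ (MY u) (MY v)); congr (gam _ _); rewrite -big_split /=.
  by apply: eq_bigr => i _; rewrite linearD scalerDl.
- move=> c v r; rewrite -(gam_scale _ _ (MY v)); congr (gam _ _); rewrite scaler_sumr.
  by apply: eq_bigr => i _; rewrite linearZ scalerA.
- by move=> v r s; apply: gg; apply: MY.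
Qed.

Let Y_basis i : Y (tnth x i) = \val (y i).
Proof.
rewrite /Y (bigD1 i) //= coord_tnth eqxx scale1r big1 ?addr0 // => j ji.
by rewrite coord_tnth (negPf ji) scale0r.
Qed.

(** The substitution [phi] lives on [A], where it respects divided powers and the chain rule.
    Admissibility of the [y i] makes it preserve [O(F)]. *)
Lemma admissible_coordinates :
  exists (sigma : {lrmorphism OF -> OF}) (sigma' : OF -> OF),
    [/\ Defs.in_group x m gam sigma sigma', forall i, sigma (X i) = y i
      & forall j u, D j (sigma u) = \sum_i D j (y i) * sigma (D i u)].
Proof.
have [g0 gE gD gM [gg ggg]] := hgam; have [phi phiE] := substitution.
have eps_phi f : eps (phi f) = eps f.
  move: f; apply: (divpow_generated hA).
  - move=> v r; rewrite phiE eps_dp; case: r => [|r]; first by rewrite (g0 _ (MY v)).1 rmorph1.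
    by apply/mE_eps; apply: gE => //; apply: MY.
  - by rewrite !rmorph1.
  - by move=> c g h eg eh; rewrite linearP !rmorphD !epsZ eg eh.
  - by move=> g h eg eh; rewrite !rmorphM eg eh.
have Mphi f : M f -> M (phi f) by move=> /mE_eps f0; apply/mE_eps; rewrite eps_phi.
have phi_gam f r : M f -> phi (gam f r) = gam (phi f) r.
  move=> Mf; elim/mE_ind: f / Mf r => [r|f g Mf Mg IHf IHg r|a j s s0 r].
  - by rewrite rmorph0 !gam0 rmorph_nat.
  - rewrite gD // rmorphD gD; [|exact: Mphi|exact: Mphi].
    by rewrite rmorph_sum; apply: eq_bigr => i _; rewrite rmorphM /= IHf IHg.
  - rewrite gM; last exact: mE_dp.
    rewrite !rmorphM gM; last by apply/Mphi/mE_dp.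
    rewrite rmorphXn gam_dp // rmorphM rmorph_nat /= !phiE; congr (_ * _).
    by rewrite ggg //; apply: MY.
have phi_chain j f : dA j (phi f) = \sum_i dA j (\val (y i)) * phi (dA i f).
  move: f; apply: (divpow_generated hA).
  - move=> v [|r]; rewrite !phiE.
      rewrite (g0 _ (MY v)).1 (drv1 (dAM j)) big1 // => i _.
      by rewrite dA_dp rmorph0 mulr0.
    rewrite deriv_gam; last exact: MY.
    rewrite (drv_sum (dAL j)) mulr_sumr; apply: eq_bigr => i _.
    by rewrite (drvZ (dAL j)) dA_dp linearZ /= phiE -!scalerAr mulrC.
  - rewrite rmorph1 (drv1 (dAM j)) big1 // => i _.
    by rewrite (drv1 (dAM i)) rmorph0 mulr0.
  - move=> c g h eg eh; rewrite linearP dAL eg eh scaler_sumr -big_split /=.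
    by apply: eq_bigr => i _; rewrite dAL linearP mulrDr scalerAr.
  - move=> g h eg eh; rewrite rmorphM dAM eg eh mulr_suml mulr_sumr -big_split /=.
    by apply: eq_bigr => i _; rewrite dAM rmorphD !rmorphM /=; ring.
have phiO (u : OF) : inO (phi (\val u)).
  move: u; apply: (@flag_algebra_ind (fun u => inO (phi (\val u))))
    => [|c u v eu ev|u v eu ev|j r rj].
  - by rewrite !rmorph1 rpred1.
  - by rewrite !linearP /= rpredD // rpredZ.
  - by rewrite !rmorphM rpredM.
  - by rewrite divpowOE // phiE Y_basis yadm.
have [J' [JJ' _]] : exists J' : 'M[OF]_n,
    (\matrix_(i, j) D j (y i)) *m J' = 1%:M /\ J' *m (\matrix_(i, j) D j (y i)) = 1%:M.
  apply: (local_mxinv epsOZ mpow_nilpotent).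
  rewrite (_ : map_mx _ _ = \matrix_(i, j) epsO (D j (y i))) //.
  by apply/matrixP => i j; rewrite !mxE.
(* Solving the chain rule with the inverse Jacobian shows that the kernel of [phi] is stable under
   derivations; Taylor coefficients then give injectivity. *)
have ker_dA f i : phi f = 0 -> phi (dA i f) = 0.
  move=> f0; have h j : \sum_k dA j (\val (y k)) * phi (dA k f) = 0.
    by rewrite -phi_chain f0 (drv0 (dAL j)).
  transitivity (\sum_j (\sum_k dA j (\val (y k)) * phi (dA k f)) * \val (J' j i)).
    have Jk k : \sum_j \val (D j (y k) * J' j i) = (k == i)%:R.
      transitivity (\val (((k == i)%:R : OF))); last by rewrite rmorph_nat.
      have /matrixP/(_ k i) := JJ'; rewrite !mxE => <-; rewrite linear_sum.
      by apply: eq_bigr => j _; rewrite mxE.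
    transitivity (\sum_k (\sum_j \val (D j (y k) * J' j i)) * phi (dA k f)).
      rewrite (bigD1 i) //= Jk eqxx mul1r big1 ?addr0 // => k /negPf ki.
      by rewrite Jk ki mul0r.
    rewrite (eq_bigr _ (fun k _ => mulr_suml _ _ _ _)) exchange_big /=.
    apply: eq_bigr => j _; rewrite mulr_suml; apply: eq_bigr => k _.
    by rewrite -[flag_val (D _ _)]/(\val (D j (y k))) val_D mulrAC.
  by rewrite big1 // => j _; rewrite h mul0r.
have phi_inj : injective phi.
  move=> f g fg; apply/eqP; rewrite -subr_eq0; apply/eqP.
  have : phi (f - g) = 0 by rewrite rmorphB /= fg subrr.
  move: (f - g) => h h0; apply: dword_eq0 => w.
  rewrite -eps_phi (_ : phi _ = 0) ?rmorph0 //.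
  by elim: w h h0 => [//|i w IH] h h0; apply: IH; apply: ker_dA.
have [sigma sigmaE] : exists s : {lrmorphism OF -> OF}, forall u, \val (s u) = phi (\val u).
  pose s u : OF := FlagAlgebra (phiO u).
  have [|||g gE'] := @lrmorphism_exists _ _ _ s.
  - by move=> c u v; apply: val_inj; rewrite /= !linearP.
  - by move=> u v; apply: val_inj; rewrite /= !rmorphM.
  - by apply: val_inj; rewrite /= !rmorph1.
  by exists g => u; rewrite gE'.
have sigma_inj : injective sigma.
  by move=> u v uv; apply: val_inj; apply: phi_inj; rewrite -!sigmaE uv.
have sigma_surj := inj_endo_surj flag_algebra_finite (linearP sigma) sigma_inj.
pose sigma' u := projT1 (cid (sigma_surj u)).
have sK' : cancel sigma' sigma by move=> u; apply: (projT2 (cid (sigma_surj u))).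
have sK : cancel sigma sigma' by move=> u; apply: sigma_inj; rewrite sK'.
exists sigma, sigma'; split.
- split=> // u r /mF_mE Mu.
  (* Conversely, if the divided power of the image lies in [O(F)], its preimage there is the divided
     power sought, because [phi] is injective on all of [A]. *)
  have h (v : OF) : \val v = gam (\val u) r -> \val (sigma v) = gam (\val (sigma u)) r.
    by move=> vE; rewrite !sigmaE vE phi_gam.
  split=> //; split=> [uO|suO].
    by rewrite -(h (FlagAlgebra uO)) //; apply: valP.
  have [v vE] := sigma_surj (FlagAlgebra suO).
  have : \val (sigma v) = gam (\val (sigma u)) r by rewrite vE.
  by rewrite !sigmaE -phi_gam // => /phi_inj <-; apply: valP.
- move=> i; apply: val_inj; rewrite sigmaE XE phiE Y_basis.
  by case: (g0 (\val (y i))) => //; apply: mE_val.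
- move=> j u; apply: val_inj; rewrite val_D sigmaE phi_chain rmorph_sum.
  by apply: eq_bigr => i _; rewrite rmorphM /= sigmaE !val_D.
Qed.

End CoordinateChange.

(** * Conjugacy of forms *)

Lemma mF_epsO u : epsO u = 0 -> mF x m u.
Proof.
move=> u0; suff : mF x m (u - (epsO u)%:A) by rewrite u0 scale0r subr0.
have mFD (v w : OF) c : mF x m v -> mF x m w -> mF x m (c *: v + w).
  by move=> mv mw; rewrite /mF linearP; apply: in_spanD => //; apply: in_spanZ.
have mF0 : mF x m (0 : OF) by rewrite /mF rmorph0; apply: in_span0.
elim/in_span_ind: u / (span_flag_algebra u) {u0} => [|c _ v [al alb ->] IH].
  by rewrite rmorph0 scale0r subr0.
rewrite rmorphD epsOZ scalerDl -scalerA opprD addrACA -scalerBr; apply: mFD => //.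
rewrite epsOE monoOE // eps_monomial; case: forallP => [al0|nal0].
  rewrite scale1r (_ : _ - _ = 0) //; apply/eqP; rewrite subr_eq0; apply/eqP/val_inj.
  by rewrite monoOE // monomial0 ?rmorph1 // => i; apply/eqP.
rewrite scale0r subr0; apply: in_span1; exists al; split=> //; last exact: monoOE.
by apply: contrapT => h; apply: nal0 => i; apply: contraT => h'; case: h; exists i.
Qed.

(** Elements of the maximal ideal have zero p-th power, and [K] has no nilpotents. *)
Lemma epsO_morph (f : {rmorphism OF -> OF}) u : epsO u = 0 -> epsO (f u) = 0.
Proof.
move=> u0; have up : u ^+ p = 0.
  by apply: val_inj; rewrite rmorphXn rmorph0 exp_mE //; apply: mE_val.
apply/eqP; have := congr1 (fun v => epsO (f v)) up.
by rewrite !rmorphXn !rmorph0 => /eqP; rewrite expf_eq0 => /andP[].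
Qed.

Lemma W_coord (de : W D) u : de u = \sum_i de (X i) * D i u.
Proof.
have [c cE] := W_predP _ _ (valP de); rewrite [LHS]cE; apply: eq_bigr => i _.
rewrite [de (X i)]cE (bigD1 i) //= D_X eqxx mulr1 big1 ?addr0 // => j ji.
by rewrite D_X (negPf ji) mulr0.
Qed.

Definition Wof (c : 'I_n -> OF) : W D := \sum_i c i *: partial D i.

Lemma WofE c u : Wof c u = \sum_i c i * D i u.
Proof.
rewrite /Wof; elim: (index_enum _) => [|i s IH]; first by rewrite !big_nil.
by rewrite !big_cons -IH.
Qed.

Lemma Wof_X c j : Wof c (X j) = c j.
Proof.
rewrite WofE (bigD1 j) //= D_X eqxx mulr1 big1 ?addr0 // => i ij.
by rewrite D_X (negPf ij) mulr0.
Qed.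

Lemma W_ext (de de' : W D) : (forall u, de u = de' u) -> de = de'.
Proof. by move=> h; apply: val_inj; apply: funext. Qed.

Lemma W_Wof (de : W D) : de = Wof (fun i => de (X i)).
Proof. by apply: W_ext => u; rewrite WofE W_coord. Qed.

Lemma form1_Wof om c : is_form1 om -> om (Wof c) = \sum_i c i * om (partial D i).
Proof.
move=> om1; have om0 : om 0 = 0.
  have := om1 1 0 0; rewrite addr0 [1 *: _]scale1r [Z in _ = Z + _]mul1r => h.
  by apply: (addrI (om 0)); rewrite -h addr0.
rewrite /Wof; elim: (index_enum _) => [|i s IH]; first by rewrite !big_nil.
by rewrite !big_cons om1 IH.
Qed.

Lemma form1_coord om (de : W D) : is_form1 om ->
  om de = \sum_i de (X i) * om (partial D i).
Proof. by move=> om1; rewrite {1}[de]W_Wof form1_Wof. Qed.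

Lemma std_formE s f i0 (a b : 'I_s -> 'I_n) (de : W D) :
  std_form D x f i0 a b de = f * (de (X i0) + \sum_k X (a k) * de (X (b k))).
Proof.
rewrite /std_form; congr (_ * _); congr (_ + _).
by elim: (index_enum _) => [|i r IH]; rewrite ?big_nil // !big_cons -IH.
Qed.

Lemma std_form_is_form1 s f i0 (a b : 'I_s -> 'I_n) : is_form1 (std_form D x f i0 a b).
Proof.
move=> c u v; rewrite !std_formE.
have cuv g : (c *: u + v : W D) g = c * u g + v g by [].
rewrite cuv (eq_bigr (fun k => c * (X (a k) * u (X (b k))) + X (a k) * v (X (b k)))).
  by rewrite big_split /= -mulr_sumr; ring.
by move=> k _; rewrite cuv; ring.
Qed.

Section Conjugate.
Variables (om eta : W D -> OF^o) (sigma : {lrmorphism OF -> OF}) (sigma' : OF -> OF).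
Hypothesis sG : Defs.in_group x m gam sigma sigma'.
Hypothesis sI : is_image sigma sigma' om eta.

(** [is_image] places the conjugate of each partial derivative in [W]; evaluating that field through
    its coordinates is the chain rule. *)
Lemma conjugate_chain j u :
  D j (sigma u) = \sum_i D j (sigma (X i)) * sigma (D i u).
Proof.
have [sK sK' _] := sG; have [de' de'E _] := sI (partial D j).
rewrite -[LHS]sK' -[sigma' _]de'E W_coord rmorph_sum; apply: eq_bigr => i _.
by rewrite rmorphM de'E /= sK'.
Qed.

(** The point is that conjugating in the opposite direction also preserves [W]; this is obtained by
    inverting the matrix of the chain rule. *)
Lemma conjugate_inverse :
  exists2 tau : {lrmorphism OF -> OF}, (forall u, tau u = sigma' u) &
    Defs.in_group x m gam tau sigma /\ is_image tau sigma eta om.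
Proof.
have [sK sK' sgam] := sG.
have [|||tau tauE] := @lrmorphism_exists _ _ _ sigma'.
- by move=> c u v; rewrite -[u in LHS]sK' -[v in LHS]sK' -linearP sK.
- by move=> u v; rewrite -[u in LHS]sK' -[v in LHS]sK' -rmorphM sK.
- by rewrite -[1 in LHS](rmorph1 sigma) sK.
exists tau => //.
have tK : cancel tau sigma by move=> u; rewrite tauE.
have tK' : cancel sigma tau by move=> u; rewrite tauE.
split.
  split=> // f r mf.
  have mf' : mF x m (tau f).
    by apply: mF_epsO; apply: epsO_morph; rewrite epsOE; apply/mE_eps; apply: mF_mE.
  have [s1 s2] := sgam _ r mf'; rewrite tK in s1 s2; split.
    by split=> h; apply/s1.
  move=> h hE.
  have gO : gam (\val (tau f)) r \in flag_pred p F dp by apply/s1; rewrite -hE; apply: valP.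
  have := s2 (FlagAlgebra gO) erefl; rewrite -hE => /val_inj <-.
  exact: (congr1 \val (tK' (FlagAlgebra gO))).
(* [P] is the Jacobian of [sigma], and [Q] is the image under [sigma] of the Jacobian of the
   inverse. *)
pose P := \matrix_(j, i) D j (sigma (X i)).
pose Q := \matrix_(i, l) sigma (D i (sigma' (X l))).
have /mulmx1C QP : P *m Q = 1%:M.
  apply/matrixP => j l; rewrite !mxE -D_X -{1}(sK' (X l)) conjugate_chain.
  by apply: eq_bigr => i _; rewrite !mxE.
have QD k u : sigma (D k (sigma' u)) = \sum_j Q k j * D j u.
  transitivity (\sum_j Q k j * \sum_i P j i * sigma (D i (sigma' u))).
    rewrite (eq_bigr _ (fun j _ => mulr_sumr _ _ _ _)) exchange_big /=.
    rewrite (bigD1 k) //= [Z in _ + Z]big1 => [|i ik].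
      have /matrixP/(_ k k) := QP; rewrite !mxE eqxx => h1; rewrite addr0.
      rewrite (eq_bigr (fun j => Q k j * P j k * sigma (D k (sigma' u)))).
        by rewrite -mulr_suml h1 mul1r.
      by move=> j _; rewrite mulrA.
    have /matrixP/(_ k i) := QP; rewrite !mxE eq_sym (negPf ik) => h1.
    rewrite (eq_bigr (fun j => Q k j * P j i * sigma (D i (sigma' u)))).
      by rewrite -mulr_suml h1 mul0r.
    by move=> j _; rewrite mulrA.
  apply: eq_bigr => j _; congr (_ * _); rewrite -{2}(sK' u) conjugate_chain.
  by apply: eq_bigr => i _; rewrite mxE.
move=> de.
pose de' := Wof (fun j => \sum_k sigma (de (X k)) * Q k j).
have de'E u : de' u = sigma (de (tau u)).
  rewrite WofE W_coord rmorph_sum (eq_bigr _ (fun j _ => mulr_suml _ _ _ _)) exchange_big.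
  apply: eq_bigr => k _; rewrite rmorphM tauE /= QD mulr_sumr.
  by apply: eq_bigr => j _; rewrite mulrA.
exists de' => //.
have [de2 de2E ->] := sI de'; transitivity (om de2); last exact/esym/tK'.
by congr om; apply: W_ext => u; rewrite de2E de'E sK tauE sK.
Qed.

End Conjugate.

Lemma forms_conjugate_sym (om eta : W D -> OF^o) :
  forms_conjugate x m gam om eta -> forms_conjugate x m gam eta om.
Proof.
case=> sigma [sigma' [sG sI]]; have [tau _ [tG tI]] := conjugate_inverse sG sI.
by exists tau, sigma.
Qed.

Lemma forms_conjugate_scale (om eta : W D -> OF^o) h : invertible h ->
    forms_conjugate x m gam om eta ->
  exists2 h', invertible h' & forms_conjugate x m gam (h *: om) (h' *: eta).
Proof.
case=> g hg [sigma [sigma' [sG sI]]]; exists (sigma h).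
  by exists (sigma g); rewrite -rmorphM hg rmorph1.
exists sigma, sigma'; split=> // de; have [de' de'E etaE] := sI de.
by exists de' => //; rewrite /= [LHS](_ : _ = sigma h * eta de) // etaE -rmorphM.
Qed.

Hypothesis hp2 : (2 < p)%N.

(** The normal form writes [om] as a standard expression in new coordinates; the group element
    sending each [X i] to [y i] carries the standard form to [om]. *)
Lemma normal_form_conjugate s (i0 : 'I_n) (a b : 'I_s -> 'I_n) (N : 'M[K]_n)
    (e : 'I_n -> K) (om : W D -> OF^o) :
    is_form1 om -> pair_partition i0 a b -> N \in unitmx -> height_compatible m N ->
    (forall j, epsO (om (partial D j)) = N i0 j) ->
    (forall i j, epsO (D i (om (partial D j)) - D j (om (partial D i))) =
       \sum_k (N (a k) i * N (b k) j - N (a k) j * N (b k) i)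
       + (N i0 i * e j - N i0 j * e i)) ->
  exists2 f, invertible f & forms_conjugate x m gam om (std_form D x f i0 a b).
Proof.
move=> om1 hab uN hN om0 dom0.
have two0 : 2%:R != 0 :> K by rewrite -(dvdn_pcharf hpK) gtnNdvd.
have [y [f [[g fg] omE yN]]] := contact_normal_form epsOZ DL DM D_X epsO_X mpow_nilpotent
  hab two0 uN om0 dom0.
have lin0 i : epsO (\sum_j N i j *: X j) = 0.
  rewrite rmorph_sum big1 // => j _.
  by apply: etrans (epsOZ _ _) _; rewrite epsO_X mulr0.
have m20 u : mpow epsO 2 u -> epsO u = 0 by move=> mu; apply/(mpow1P epsO)/mpow_pred.
have y0 i : epsO (y i) = 0 by rewrite -(subrK (\sum_j N i j *: X j) (y i)) rmorphD lin0 m20 ?addr0.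
have yJ : \matrix_(i, j) epsO (D j (y i)) \in unitmx.
  rewrite (_ : \matrix_(i, j) _ = N) //; apply/matrixP => i j; rewrite mxE.
  rewrite -(subrK (\sum_j N i j *: X j) (y i)) (drvD (DL j)) rmorphD.
  have /(mpow1P epsO) -> : mpow epsO 1 (D j (y i - \sum_j N i j *: X j)).
    exact: (mpow_deriv DL DM).
  rewrite add0r (drv_sum (DL j)) (bigD1 j) //= (drvZ (DL j)) D_X eqxx big1 => [|l lj].
    by rewrite addr0; apply: etrans (epsOZ _ _) _; rewrite rmorph1 mulr1.
  by rewrite (drvZ (DL j)) D_X eq_sym (negPf lj) scaler0.
have yadm i r : (r < p ^ m i)%N -> gam (\val (y i)) r \in flag_pred p F dp.
  exact: gam_admissible hN (yN i).
have [sigma [sigma' [sG sX schain]]] := admissible_coordinates y0 yadm yJ.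
have [sK sK' _] := sG.
have [|||tau tauE] := @lrmorphism_exists _ _ _ sigma'.
- by move=> c u v; rewrite -[u in LHS]sK' -[v in LHS]sK' -linearP sK.
- by move=> u v; rewrite -[u in LHS]sK' -[v in LHS]sK' -rmorphM sK.
- by rewrite -[1 in LHS](rmorph1 sigma) sK.
(* The unit is pulled back, because [sigma] acts on the coefficient too. *)
exists (sigma' f).
  by exists (sigma' g); rewrite -!tauE -rmorphM fg rmorph1.
apply: forms_conjugate_sym; exists sigma, sigma'; split=> // de.
have de_chain u : de (sigma u) = \sum_i de (y i) * sigma (D i u).
  rewrite W_coord (eq_bigr (fun j => \sum_i de (X j) * (D j (y i) * sigma (D i u)))).
    rewrite exchange_big /=; apply: eq_bigr => i _.
    by rewrite W_coord mulr_suml; apply: eq_bigr => j _; rewrite mulrA.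
  by move=> j _; rewrite schain mulr_sumr.
exists (Wof (fun i => sigma' (de (y i)))).
  move=> u; rewrite WofE de_chain -tauE rmorph_sum; apply: eq_bigr => i _.
  by rewrite rmorphM /= !tauE sK.
rewrite std_formE Wof_X rmorphM rmorphD rmorph_sum /= !sK'.
rewrite (form1_coord _ om1) (eq_bigr (fun j => f * (de (X j) * D j (y i0)
    + \sum_k y (a k) * (de (X j) * D j (y (b k)))))); last first.
  move=> j _; rewrite omE /contact_coef mulrCA mulrDr; congr (_ * (_ + _)).
  by rewrite mulr_sumr; apply: eq_bigr => k _; rewrite mulrCA.
rewrite -mulr_sumr big_split /= -W_coord; congr (_ * (_ + _)).
rewrite exchange_big /=; apply: eq_bigr => k _.
by rewrite rmorphM Wof_X /= sK' sX -mulr_sumr -W_coord.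
Qed.

(** Take the least power of the maximal ideal that kills every [v i], and choose [t] in the
    preceding power. *)
Lemma socle_multiple (v : 'I_n -> OF) : (exists i, v i != 0) ->
  exists t, (exists i, t * v i != 0) /\
    forall g i, epsO g = 0 -> g * (t * v i) = 0.
Proof.
move=> v0; have [N hN] := mpow_nilpotent.
pose kills k := forall t i, mpow epsO k t -> t * v i = 0.
have : exists k, `[< kills k >].
  by exists N; apply/asboolP => t i /hN ->; rewrite mul0r.
case/ex_minnP => -[|k] /asboolP kk kmin.
  by case: v0 => i /eqP[]; rewrite -[v i]mul1r; apply: kk; apply: mpow_all.
have [t [mt [i ti]]] : exists t, mpow epsO k t /\ exists i, t * v i != 0.
  apply: contrapT => h; have /kmin : `[< kills k >]; last by rewrite ltnn.
  apply/asboolP => t i mt; apply/eqP; apply: contraT => ti.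
  by case: h; exists t; split=> //; exists i.
exists t; split; first by exists i.
by move=> g j g0; rewrite mulrA; apply: kk; apply: mpow_step.
Qed.

Lemma socle_element : (0 < n)%N -> exists2 t : OF, t != 0 & forall g, epsO g = 0 -> g * t = 0.
Proof.
move=> n0; have [|t [[i ti] tg]] := @socle_multiple (fun=> 1).
  by exists (Ordinal n0); rewrite oner_neq0.
exists t; first by rewrite mulr1 in ti.
by move=> g g0; have := tg g i g0; rewrite mulr1.
Qed.

Lemma epsO_unit (u : OF) : epsO u != 0 -> invertible u.
Proof. exact: (local_unit epsOZ mpow_nilpotent). Qed.

(** * The contact condition at the closed point *)

Section Contact.
Variable om : W D -> OF^o.
Hypotheses (n0 : (0 < n)%N) (homc : contact_form x om).
Local Notation omc j := (om (partial D j)).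

Let om1 : is_form1 om. Proof. by case: homc. Qed.

Lemma d1E (de de' : W D) : d1 x om de de' =
  \sum_i \sum_j de (X i) * de' (X j) * (D i (omc j) - D j (omc i)).
Proof.
transitivity (\sum_j (de (omc j) * de' (X j) - de' (omc j) * de (X j))).
  rewrite /d1; elim: (index_enum _) => [|i r IH]; first by rewrite !big_nil.
  by rewrite !big_cons -IH.
rewrite sumrB.
have dsum (u w : W D) : \sum_j u (omc j) * w (X j) =
    \sum_i \sum_j u (X i) * w (X j) * D i (omc j).
  rewrite exchange_big /=; apply: eq_bigr => j _.
  by rewrite W_coord mulr_suml; apply: eq_bigr => i _; rewrite mulrAC.
rewrite !dsum [Z in _ - Z]exchange_big -sumrB /=; apply: eq_bigr => i _.
rewrite -sumrB; apply: eq_bigr => j _.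
by rewrite mulrBr [de' _ * _]mulrC.
Qed.

Lemma P_ofP (de : W D) : P_of x om de <-> forall de', d1 x om de de' = 0.
Proof. by split=> [h de'|h]; [rewrite -/(contract de _ de') h|apply: funext]. Qed.

(** Suppose [om] vanishes at the point. If [om] is nonzero, the P-part [a] of a suitable partial
    derivative has a unit coefficient; a socle multiple of [a] then lies in both P and Q without
    being zero. *)
Lemma contact_nonzero : exists j, epsO (omc j) != 0.
Proof.
have [_ [PQ PQ0]] := homc.
apply: contrapT => h; have om0 j : epsO (omc j) = 0.
  by apply/eqP; apply: contraT => h'; case: h; exists j.
have [j omj] : exists j, omc j != 0.
  apply: contrapT => h'; have omj j : omc j = 0.
    by apply/eqP; apply: contraT => h2; case: h'; exists j.
  (* If [om] is zero, every field lies in both P and Q. *)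
  have : partial D (Ordinal n0) = 0.
    apply: PQ0; last exact: omj.
    apply/P_ofP => de'; rewrite d1E big1 // => i _; rewrite big1 // => j _.
    by rewrite !omj !(drv0 (DL _)) subrr mulr0.
  move/(congr1 (fun de : W D => de (X (Ordinal n0)))); rewrite [LHS]D_X eqxx => /eqP.
  by rewrite (negPf (oner_neq0 _)).
have [|t [[i ti] tg]] := @socle_multiple (fun i => omc i); first by exists j.
have [a [b [Pa Qb ab]]] := PQ (partial D i).
have omi : omc i = om a.
  by rewrite ab -[a in LHS]scale1r om1 [om b]Qb addr0 /= mul1r.
have [l al] : exists l, epsO (a (X l)) != 0.
  apply: contrapT => hl; case/eqP: ti; rewrite omi (form1_coord _ om1) mulr_sumr big1 // => l _.
  rewrite mulrCA; apply: tg; apply/eqP; apply: contraT => h'; case: hl; by exists l.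
have [t' t'0 t'g] := socle_element n0.
have : t' *: a = 0.
  apply: PQ0.
    apply/P_ofP => de'; have /P_ofP/(_ de') := Pa; rewrite !d1E => da.
    transitivity (t' * 0 : OF); last by rewrite mulr0.
    rewrite -[Z in _ = t' * Z]da mulr_sumr; apply: eq_bigr => i' _.
    rewrite mulr_sumr; apply: eq_bigr => j' _.
    by rewrite [(t' *: a : W D) _](_ : _ = t' * a (X i')) // !mulrA.
  rewrite /Q_of (form1_coord _ om1) big1 // => i' _.
  rewrite [(t' *: a : W D) _](_ : _ = t' * a (X i')) //.
  by rewrite mulrC mulrA (t'g _ (om0 i')) mul0r.
move/(congr1 (fun de : W D => de (X l))) => /= ta.
have [g ag] := epsO_unit al.
case/eqP: t'0; rewrite -[t']mulr1 -ag mulrA [t' * _](_ : _ = 0) ?mul0r //.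
Qed.

(** Let [v] be a vector of the radical, seen as a field with constant coefficients. A socle multiple
    of it lies in both P and Q, hence is zero, which forces [v] to vanish. *)
Lemma contact_nondegenerate (v : 'I_n -> K) : \sum_i v i * epsO (omc i) = 0 ->
  (forall w : 'I_n -> K, \sum_i w i * epsO (omc i) = 0 ->
    \sum_i \sum_j v i * epsO (D i (omc j) - D j (omc i)) * w j = 0) ->
  forall i, v i = 0.
Proof.
have [_ [PQ PQ0]] := homc; have [t t0 tg] := socle_element n0.
pose B i j := epsO (D i (omc j) - D j (omc i)).
have Bskew i j : B j i = - B i j by rewrite /B -rmorphN opprB.
have eps_om (de : W D) : epsO (om de) = \sum_i epsO (de (X i)) * epsO (omc i).
  by rewrite (form1_coord _ om1) rmorph_sum; apply: eq_bigr => i _; rewrite rmorphM.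
have eps_d1 (de de' : W D) : epsO (d1 x om de de') =
    \sum_i \sum_j epsO (de (X i)) * B i j * epsO (de' (X j)).
  rewrite d1E rmorph_sum; apply: eq_bigr => i _; rewrite rmorph_sum; apply: eq_bigr => j _.
  by rewrite !rmorphM mulrAC.
move=> vc vB; pose de0 := Wof (fun i => (v i)%:A : OF).
have de0X i : epsO (de0 (X i)) = v i.
  by rewrite Wof_X; apply: etrans (epsOZ _ _) _; rewrite rmorph1 mulr1.
(* Orthogonality to the Q-part is the hypothesis; the P-part is orthogonal to everything, by skew
   symmetry on either side. *)
have vBa (de : W D) : \sum_i \sum_j v i * B i j * epsO (de (X j)) = 0.
  have [a [b [Pa Qb ->]]] := PQ de.
  have -> : \sum_i \sum_j v i * B i j * epsO ((a + b : W D) (X j)) =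
      \sum_i \sum_j v i * B i j * epsO (a (X j)) + \sum_i \sum_j v i * B i j * epsO (b (X j)).
    rewrite -big_split /=; apply: eq_bigr => i _; rewrite -big_split /=; apply: eq_bigr => j _.
    by rewrite -mulrDr -rmorphD.
  rewrite (vB (fun j => epsO (b (X j)))) ?addr0; last by rewrite -eps_om [om b]Qb rmorph0.
  have /P_ofP/(_ de0)/(congr1 epsO) := Pa; rewrite eps_d1 rmorph0 => h.
  apply/eqP; rewrite -oppr_eq0; apply/eqP; rewrite -[RHS]h [RHS]exchange_big -sumrN.
  apply: eq_bigr => i _; rewrite -sumrN; apply: eq_bigr => j _.
  by rewrite de0X (Bskew j i); ring.
have : t *: de0 = 0.
  have tX i : (t *: de0 : W D) (X i) = t * de0 (X i) by [].
  apply: PQ0.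
    apply/P_ofP => de'.
    transitivity (t * d1 x om de0 de').
      rewrite !d1E mulr_sumr; apply: eq_bigr => i _; rewrite mulr_sumr; apply: eq_bigr => j _.
      by rewrite tX !mulrA.
    rewrite mulrC tg // eps_d1 -[RHS](vBa de'); apply: eq_bigr => i _; apply: eq_bigr => j _.
    by rewrite de0X.
  rewrite /Q_of; transitivity (t * om de0).
    rewrite !(form1_coord _ om1) mulr_sumr; apply: eq_bigr => i _.
    by rewrite tX mulrA.
  by rewrite mulrC tg // eps_om -[RHS]vc; apply: eq_bigr => i _; rewrite de0X.
move=> tde i; apply/eqP; apply: contraT => vi; case/eqP: t0.
move/(congr1 (fun de : W D => de (X i))): tde.
rewrite [LHS](_ : _ = t * de0 (X i)) // Wof_X -scalerAr mulr1 => /eqP.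
by rewrite scaler_eq0 (negPf vi) /= => /eqP.
Qed.

End Contact.

Lemma contact_conjugate (om : W D -> OF^o) : (0 < n)%N -> contact_form x om ->
  exists s f i0 (a b : 'I_s -> 'I_n),
    [/\ n = s.*2.+1, invertible f, pair_partition i0 a b
      & forms_conjugate x m gam om (std_form D x f i0 a b)].
Proof.
move=> n0 omc; pose c j := epsO (om (partial D j)).
pose B : 'M[K]_n := \matrix_(i, j) epsO (D i (om (partial D j)) - D j (om (partial D i))).
have Balt i : B i i = 0 by rewrite mxE subrr rmorph0.
have Bskew i j : B j i = - B i j by rewrite !mxE -rmorphN opprB.
have Bnd (v : 'I_n -> K) : \sum_i v i * c i = 0 ->
  (forall w : 'I_n -> K, \sum_i w i * c i = 0 -> \sum_i \sum_j v i * B i j * w j = 0) ->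
  forall i, v i = 0.
  move=> vc vB; apply: (contact_nondegenerate n0 omc vc) => w wc.
  rewrite -[RHS](vB w wc); apply: eq_bigr => i _; apply: eq_bigr => j _.
  by rewrite mxE.
have [s [i0 [a [b [N [e [hab uN hN N0 NB]]]]]]] :=
  flag_symplectic_basis m Balt Bskew Bnd (contact_nonzero n0 omc).
have [om1 _] := omc.
have [||f fi cj] := @normal_form_conjugate s i0 a b N e om om1 hab uN hN.
- by move=> j; rewrite N0.
- by move=> i j; rewrite -NB mxE.
exists s, f, i0, a, b; split=> //; exact: pair_partition_size hab.
Qed.

(** * Height invariants of the standard forms *)

Lemma iter_dA_flag j (u : OF) r : (p ^ m j <= r)%N -> iter r (dA j) (\val u) = 0.
Proof.
have it_lin t c f g : iter t (dA j) (c *: f + g) = c *: iter t (dA j) f + iter t (dA j) g.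
  by elim: t => //= t ->; rewrite dAL.
have it0 t : iter t (dA j) 0 = 0 by elim: t => //= t ->; rewrite (drv0 (dAL j)).
have it_mono t al : (al j < t)%N -> iter t (dA j) (mono al) = 0.
  elim: t al => // t IH al alt; rewrite iterSr dA_monomial.
  by case e: (al j) => [|k]; rewrite ?it0 // IH // eqxx -ltnS -e.
move=> rm; elim/in_span_ind: u / (span_flag_algebra u) => [|c _ v [al alb ->] IH].
  by rewrite rmorph0 it0.
by rewrite linearP /= it_lin IH monoOE // it_mono ?scaler0 ?addr0 // (leq_trans (alb j)).
Qed.

(** Let r = p ^ (m i - 1). The r-th divided power of [X i], hence that of its image, lies in [O(F)].
    If m j < m i, the r-fold j-th derivative kills [O(F)], yet at the point it is the r-th power of
    the Jacobian entry. *)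
Lemma group_height (sigma : {lrmorphism OF -> OF}) sigma' i j :
  Defs.in_group x m gam sigma sigma' -> epsO (D j (sigma (X i))) != 0 -> (m i <= m j)%N.
Proof.
case=> _ _ sgam c0; rewrite leqNgt; apply/negP => mji.
pose r := (p ^ (m i).-1)%N.
have rO : gam (\val (X i)) r \in flag_pred p F dp.
  rewrite XE hgamdp -divpowOE ?(valP (divpowO i r)) //.
  by rewrite ltn_exp2l ?prime_gt1 // prednK // height_gt0.
have [/(_ rO) srO _] := (sgam _ r (mF_X i)).1.
have My : M (\val (sigma (X i))) by apply: mE_val; apply: epsO_morph; apply: epsO_X.
have := eps_iter_gam j 1 My (leqnn r).
rewrite eqxx rmorph1 mul1r !mulr1 -val_D -epsOE (@iter_dA_flag j (FlagAlgebra srO)).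
  by rewrite rmorph0 => /esym/eqP; rewrite expf_eq0 (negPf c0) andbF.
by rewrite leq_exp2l ?prime_gt1 // -ltnS prednK // height_gt0.
Qed.

(** The second derivatives of [y i0] cancel, and terms with an undifferentiated [y k] vanish at the
    point. *)
Lemma contact_coef_curl (f : OF) (y : 'I_n -> OF) s (i0 : 'I_n) (a b : 'I_s -> 'I_n) i j :
    (forall k, epsO (y k) = 0) ->
  epsO (D i (f * contact_coef D i0 a b y j) - D j (f * contact_coef D i0 a b y i)) =
  epsO (D i f) * epsO (D j (y i0)) - epsO (D j f) * epsO (D i (y i0))
  + epsO f * \sum_k (epsO (D i (y (a k))) * epsO (D j (y (b k)))
                     - epsO (D j (y (a k))) * epsO (D i (y (b k)))).
Proof.
move=> y0; have eps_coef l : epsO (contact_coef D i0 a b y l) = epsO (D l (y i0)).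
  rewrite rmorphD rmorph_sum big1 ?addr0 // => k _.
  by rewrite rmorphM y0 mul0r.
have eps_dcoef l t : epsO (D l (contact_coef D i0 a b y t)) =
    epsO (D l (D t (y i0))) + \sum_k epsO (D l (y (a k))) * epsO (D t (y (b k))).
  rewrite (drvD (DL l)) (drv_sum (DL l)) rmorphD rmorph_sum; congr (_ + _).
  by apply: eq_bigr => k _; rewrite DM rmorphD !rmorphM y0 mul0r addr0.
rewrite !DM rmorphB !rmorphD !rmorphM !eps_coef !eps_dcoef (D_comm i j) sumrB.
by ring.
Qed.

Lemma invertible_epsO (f : OF) : invertible f -> epsO f != 0.
Proof.
case=> g fg; apply: contraTneq (oner_neq0 K) => f0.
by rewrite -(rmorph1 epsO) -fg rmorphM f0 mul0r eqxx.
Qed.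

Lemma std_form_partial s f (i0 : 'I_n) (a b : 'I_s -> 'I_n) j :
  std_form D x f i0 a b (partial D j) = f * contact_coef D i0 a b (fun i => X i) j.
Proof. exact: std_formE. Qed.

(** Comparing values at the point relates row [i0] of the Jacobian to [j0]; comparing curls relates
    the two pair matrices by congruence. Only inequalities result, and symmetry of conjugacy
    reverses them. *)
Lemma std_form_invariants s f g (i0 j0 : 'I_n) (a b a' b' : 'I_s -> 'I_n) :
    pair_partition i0 a b -> pair_partition j0 a' b' -> invertible f -> invertible g ->
    forms_conjugate x m gam (std_form D x f i0 a b) (std_form D x g j0 a' b') ->
  (m i0 <= m j0)%N /\
  forall q r, (pair_count a' b' m q r <= pair_count a b m q r)%N.
Proof.
move=> hab hab' fi gi [sigma [sigma' [sG sI]]].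
pose y i := sigma (X i); pose N : 'M[K]_n := \matrix_(i, j) epsO (D j (y i)).
have hN : height_compatible m N by move=> i j; rewrite mxE; apply: group_height sG.
have y0 i : epsO (y i) = 0 by apply: epsO_morph; apply: epsO_X.
have [_ sK' _] := sG.
have eqj j : g * contact_coef D j0 a' b' (fun i => X i) j
    = sigma f * contact_coef D i0 a b y j.
  rewrite -std_form_partial; have [de de'E ->] := sI (partial D j).
  rewrite std_formE rmorphM rmorphD rmorph_sum /= !de'E sK'; congr (_ * (_ + _)).
  by apply: eq_bigr => k _; rewrite rmorphM de'E /= sK'.
have f0 : epsO (sigma f) != 0.
  by apply: invertible_epsO; case: fi => f' ff'; exists (sigma f'); rewrite -rmorphM ff' rmorph1.
have g0 := invertible_epsO gi.
have DX j k : epsO (D j (X k)) = (k == j)%:R by rewrite D_X rmorph_nat eq_sym.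
have N0 j : epsO g * (j0 == j)%:R = epsO (sigma f) * N i0 j.
  have /(congr1 epsO) := eqj j; rewrite !rmorphM !rmorphD !rmorph_sum.
  rewrite !big1 => [|k _|k _]; try by rewrite rmorphM ?y0 ?epsO_X mul0r.
  by rewrite !addr0 DX mxE.
split.
  apply: hN; have := N0 j0; rewrite eqxx mulr1 => e.
  by apply: contraNneq g0 => N00; rewrite e N00 mulr0.
apply: (pair_count_le (lam := epsO (sigma f) / epsO g) hab hab' hN) => i j ij0 jj0.
(* Hence the terms of the curl coming from the differentials of the units vanish on indices other
   than [j0]. *)
have Ni t : t != j0 -> N i0 t = 0.
  move=> tj; have /esym/eqP := N0 t; rewrite eq_sym in tj; rewrite (negPf tj) mulr0.
  by rewrite mulf_eq0 (negPf f0) => /eqP.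
have := contact_coef_curl g j0 a' b' i j epsO_X; rewrite !eqj contact_coef_curl //.
have Nij t : epsO (D t (y i0)) = N i0 t by rewrite mxE.
rewrite !DX ![j0 == _]eq_sym !Nij !Ni // (negPf ij0) (negPf jj0) !mulr0 subrr !add0r => e.
have -> : pair_mx K a' b' i j = \sum_k (epsO (D i (X (a' k))) * epsO (D j (X (b' k)))
                     - epsO (D j (X (a' k))) * epsO (D i (X (b' k)))).
  by rewrite mxE; apply: eq_bigr => k _; rewrite !DX.
apply: (mulfI g0); rewrite -e mulrA mulrCA mulfV // mulr1; congr (_ * _).
by apply: eq_bigr => k _; rewrite !mxE.
Qed.

(** Only the 1-jet matters, so a signed permutation matrix is fed to the normal form; a pair matched
    crosswise costs a sign in the alternating form. *)
Lemma permuted_std_form s f (i0 j0 : 'I_n) (a b a' b' : 'I_s -> 'I_n) (pi : {perm 'I_n}) :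
    pair_partition i0 a b -> pair_partition j0 a' b' -> invertible f ->
    pi i0 = j0 -> (forall k, exists l, [set pi (a k); pi (b k)] = [set a' l; b' l]) ->
    (forall i, m (pi i) = m i) ->
  exists2 g, invertible g &
    forms_conjugate x m gam (std_form D x f i0 a b) (std_form D x g j0 a' b').
Proof.
move=> hab hab' fi pi0 piab mpi.
pose l k := projT1 (cid (piab k)).
have lE k : [set pi (a k); pi (b k)] = [set a' (l k); b' (l k)].
  exact: projT2 (cid (piab k)).
have linj : injective l.
  move=> k k' lkk'; have : pi (a k) \in [set pi (a k'); pi (b k')].
    by rewrite lE -lkk' -lE !inE eqxx.
  rewrite !inE !(inj_eq perm_inj) (negPf (pair_neq hab _ _)) orbF => /eqP.
  exact: pair_injl hab _ _.
(* The sign is -1 exactly when the permutation exchanges the roles of first and second member. *)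
pose sg k : K := if pi (a k) == a' (l k) then 1 else -1.
pose sign := pair_glue a b 1 (fun=> 1) sg.
have piE k : if pi (a k) == a' (l k) then pi (b k) = b' (l k)
    else pi (a k) = b' (l k) /\ pi (b k) = a' (l k).
  have pab : pi (b k) != pi (a k) by rewrite (inj_eq perm_inj) eq_sym (pair_neq hab).
  have pa : pi (a k) \in [set a' (l k); b' (l k)] by rewrite -lE !inE eqxx.
  have pb : pi (b k) \in [set a' (l k); b' (l k)] by rewrite -lE !inE eqxx orbT.
  move: pa pb pab; rewrite !inE; case: eqP => [->|_ /eqP ->] /=.
    by move=> _ /orP[/eqP ->|/eqP //]; rewrite eqxx.
  by move=> /orP[/eqP -> //|/eqP ->]; rewrite eqxx.
have sign0 i : sign i != 0.
  rewrite /sign; elim/(pair_ind hab): i => [|k|k].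
  - by rewrite (pair_glue0 hab) oner_neq0.
  - by rewrite (pair_gluel hab) oner_neq0.
  - by rewrite (pair_gluer hab) /sg; case: ifP; rewrite ?oppr_eq0 oner_neq0.
pose N : 'M[K]_n := \matrix_(i, j) (sign i * (pi i == j)%:R).
have uN : N \in unitmx.
  apply: unitmx_ker => v /rowP vN; apply/rowP => i; rewrite mxE.
  have := vN (pi i); rewrite !mxE (bigD1 i) //= mxE eqxx mulr1 big1 ?addr0.
    by move/eqP; rewrite mulf_eq0 (negPf (sign0 i)) orbF => /eqP.
  by move=> k ki; rewrite mxE (inj_eq perm_inj) (negPf ki) !mulr0.
have hN : height_compatible m N.
  move=> i j; rewrite mxE mulf_eq0 (negPf (sign0 i)).
  by case: (pi i =P j) => [<-|]; rewrite ?mpi // eqxx.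
have DX j k : epsO (D j (X k)) = (k == j)%:R by rewrite D_X rmorph_nat eq_sym.
have one_inv : invertible (1 : OF) by exists 1; rewrite mulr1.
have [||g gi /forms_conjugate_sym cj] := @normal_form_conjugate s i0 a b N (fun=> 0)
  (std_form D x 1 j0 a' b') (@std_form_is_form1 _ _ _ _ _) hab uN hN.
- move=> j; rewrite std_form_partial mul1r rmorphD rmorph_sum big1 => [|k _].
    by rewrite addr0 DX mxE /sign (pair_glue0 hab) mul1r pi0.
  by rewrite rmorphM epsO_X mul0r.
- move=> i j; rewrite !std_form_partial (contact_coef_curl _ _ _ _ _ _ epsO_X).
  rewrite !(drv1 (DM _)) rmorph0 !mul0r !mulr0 subrr add0r rmorph1 mul1r addr0.
  rewrite (reindex_inj linj); apply: eq_bigr => k _.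
  rewrite !DX !mxE /sign !(pair_gluel hab) !(pair_gluer hab) /sg.
  have := piE k; case: eqP => [-> ->|_ [-> ->]]; by ring.
(* The normal form produces some unit [g] over which there is no control; scaling both forms
   replaces it by the given [f]. *)
have [h fh] : exists h, f = h * g.
  by case: gi => g' gg'; exists (f * g'); rewrite -mulrA [g' * g]mulrC gg' mulr1.
have hi : invertible h by case: fi => f' ff'; exists (g * f'); rewrite mulrA -fh.
have [h' h'i cj'] := forms_conjugate_scale hi cj.
exists h' => //.
have stdZ (c d : OF) s' (i1 : 'I_n) (c1 c2 : 'I_s' -> 'I_n) :
    c *: (std_form D x d i1 c1 c2 : W D -> OF^o) = std_form D x (c * d) i1 c1 c2.
  apply: funext => de; rewrite std_formE -mulrA -std_formE //.
by move: cj'; rewrite !stdZ -fh mulr1.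
Qed.

End DividedPowerSystem.

Theorem theorem5p2 (K : fieldType) (p : nat) (hpK : p \in [pchar K])
    (hp2 : (2 < p)%N) (E : vectType K) (F : nat -> {vspace E})
    (hF : is_flag F) (n : nat) (hn : (0 < n)%N) (x : n.-tuple E)
    (hx : compatible_basis F x) (m : 'I_n -> nat)
    (hm : forall i, is_height F (tnth x i) (m i))
    (A : comAlgType K) (dp : E -> nat -> A) (hA : is_divpow_algebra dp)
    (gam : A -> nat -> A) (hgam : is_divpow_system (mE dp x) gam)
    (hgamdp : extends_dp dp gam)
    (D : 'I_n -> flag_algebra p F dp -> flag_algebra p F dp)
    (hD : is_partials x D) :
  (forall omega : W D -> (flag_algebra p F dp)^o, contact_form x omega ->
     exists (s : nat) (f : flag_algebra p F dp) (i0 : 'I_n)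
            (a b : 'I_s -> 'I_n),
       [/\ n = s.*2.+1, invertible f, pair_partition i0 a b
         & forms_conjugate x m gam omega (std_form D x f i0 a b)]) /\
  (forall (s : nat) (f : flag_algebra p F dp) (i0 j0 : 'I_n)
          (a b a' b' : 'I_s -> 'I_n),
     n = s.*2.+1 -> invertible f ->
     pair_partition i0 a b -> pair_partition j0 a' b' ->
     ((exists2 g : flag_algebra p F dp, invertible g &
         forms_conjugate x m gam (std_form D x f i0 a b)
                                 (std_form D x g j0 a' b'))
      <->
      (exists pi : {perm 'I_n},
         [/\ pi i0 = j0,
             forall k, exists l,
               [set pi (a k); pi (b k)] = [set a' l; b' l]
           & forall i, m (pi i) = m i]))).
Proof.
have [xb xF] := hx.
(* The augmentation and the partial derivatives on all of [A] are not data of the statement; the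
   universal property supplies them. *)
have [eps [epsZ eps_dp]] := divpow_augmentation hA.
have [dA dAE] : exists dA : 'I_n -> A -> A, forall i,
    [/\ linear (dA i), forall f g, dA i (f * g) = dA i f * g + f * dA i g
      & forall v r, dA i (dp v r) = if r is r'.+1 then coord x i v *: dp v r' else 0].
  have cD i u v : coord x i (u + v) = coord x i u + coord x i v by rewrite linearD.
  have cZ i c v : coord x i (c *: v) = c * coord x i v by rewrite linearZ.
  have h i := cid (divpow_derivation hA (cD i) (cZ i)).
  by exists (fun i => projT1 (h i)) => i; apply: (projT2 (h i)).
have dAL i : linear (dA i) by case: (dAE i).
have dAM i f g : dA i (f * g) = dA i f * g + f * dA i g by case: (dAE i).
have dA_dp i v r : dA i (dp v r) = if r is r'.+1 then coord x i v *: dp v r' else 0.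
  by case: (dAE i).
split=> [omega homega|s f i0 j0 a b a' b' _ fi hab hab'].
  exact: (contact_conjugate hpK xb hA hgam hgamdp epsZ eps_dp dAL dAM dA_dp hF xF hm hD hp2
    hn homega).
have inv := std_form_invariants hpK xb hA hgam hgamdp epsZ eps_dp dAL dAM dA_dp hF xF hm hD.
have sym := forms_conjugate_sym hpK xb hA hgam epsZ eps_dp dAL dAM dA_dp hF xF hm hD.
split=> [[g gi cj]|[pi [pi0 piab mpi]]].
  have [m1 c1] := inv _ _ _ _ _ _ _ _ _ hab hab' fi gi cj.
  (* The inequalities for the reversed conjugacy turn the invariants into equalities. *)
  have [m2 c2] := inv _ _ _ _ _ _ _ _ _ hab' hab gi fi (sym _ _ cj).
  apply: pair_permutation => //; first by apply/eqP; rewrite eqn_leq m1 m2.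
  by move=> q r; apply/eqP; rewrite eqn_leq c1 c2.
exact: (permuted_std_form hpK xb hA hgam hgamdp epsZ eps_dp dAL dAM dA_dp hF xF hm hD hp2
  hab hab' fi pi0 piab mpi).
Qed.
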